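(* (ZFC) Let $k\ge 2$ and let $\bar\lambda=\langle\lambda_1,\ldots,\lambda_k\rangle$ be a finite sequence of infinite cardinals with $\lambda_1=\lambda_1^{\aleph_0}$ and $\lambda_{i+1}=2^{\lambda_i}$ for all $1\le i<k$. Then there exists an $\aleph_k$-free abelian group $F$ of cardinality $|F|=\lambda_k$ such that for any abelian group $C$ of cardinality $|C|\le\lambda_1$ the following statements are equivalent. (i) $C$ is cotorsion. (ii) $\operatorname{Ext}(F,C)=0$.
   Context: All groups are abelian, and $\operatorname{Ext}$ means $\operatorname{Ext}^1_{\mathbb{Z}}$. For an uncountable cardinal $\kappa$, a group $G$ is called $\kappa$-free if every subgroup $H\subseteq G$ of cardinality $|H|<\kappa$ is free (as an abelian group). A group $C$ is called cotorsion if $\operatorname{Ext}(F',C)=0$ for all torsion-free groups $F'$. *)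

(* Defs.v *)
From HB Require Import structures.
From mathcomp Require Import all_boot all_order all_algebra.
From mathcomp Require Import all_classical.

Set Implicit Arguments.
Unset Strict Implicit.
Unset Printing Implicit Defensive.

Import GRing.Theory.

Local Open Scope classical_set_scope.
Local Open Scope card_scope.
Local Open Scope ring_scope.

Definition card_lt (T U : Type) (A : set T) (B : set U) : bool :=
  (A #<= B) && ~~ (B #<= A).

(* Cardinals are represented by types (or sets), compared through [#<=], [#=].
   [|T|] is the successor cardinal of [|S|]: [|S| < |T|] and no cardinal lies
   strictly between them. Each cardinal below [|T|] is that of a subset of [T],
   so quantifying over subsets suffices. *)
Definition is_succ_card (S T : Type) : Prop :=
  card_lt [set: S] [set: T] /\
  forall X : set T, card_lt X [set: T] -> X #<= [set: S].

(* [|T| = aleph_n]. *)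
Fixpoint is_aleph (n : nat) (T : Type) : Prop :=
  if n is m.+1 then exists S : Type, is_aleph m S /\ is_succ_card S T
  else [set: T] #= [set: nat].

Definition Zindependent (G : zmodType) (B : set G) : Prop :=
  forall (s : seq G) (c : G -> int),
    uniq s -> {in s, forall b, B b} ->
    \sum_(b <- s) b *~ c b = 0 -> {in s, forall b, c b = 0}.

Definition Zspan (G : zmodType) (B : set G) : set G :=
  [set x | exists (s : seq G) (c : G -> int),
     {in s, forall b, B b} /\ x = \sum_(b <- s) b *~ c b].

(* The subgroup [H] is a free abelian group: it has a Z-basis. *)
Definition free_subgroup (G : zmodType) (H : zmodClosed G) : Prop :=
  exists B : set G, Zindependent B /\ Zspan B = [set x | x \in H].

(* [G] is [|K|]-free. *)
Definition card_free (K : Type) (G : zmodType) : Prop :=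
  forall H : zmodClosed G,
    card_lt [set x | x \in H] [set: K] -> free_subgroup H.

(* Since [aleph_n] is unique up to equipotence, any representative will do; the
   existential form is not vacuously true. *)
Definition aleph_free (n : nat) (G : zmodType) : Prop :=
  exists K : Type, is_aleph n K /\ card_free K G.

Definition torsion_free (G : zmodType) : Prop :=
  forall (x : G) (n : nat), (0 < n)%N -> x *+ n = 0 -> x = 0.

(* Short exact sequences 0 -> C -> E -> A -> 0. *)
Record extension (A C : zmodType) := Extension {
  ext_mid : zmodType;
  ext_in : {additive C -> ext_mid};
  ext_out : {additive ext_mid -> A};
  ext_in_inj : injective ext_in;
  ext_out_surj : forall a, exists e, ext_out e = a;
  ext_exact : forall e, ext_out e = 0 <-> exists c, ext_in c = e
}.

(* The usual equivalence of extensions; [phi] is automatically bijective by the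
   five lemma. *)
Definition ext_equiv (A C : zmodType) (E E' : extension A C) : Prop :=
  exists phi : {additive ext_mid E -> ext_mid E'},
    (forall c, phi (ext_in E c) = ext_in E' c) /\
    (forall e, ext_out E' (phi e) = ext_out E e).

Section SplitExtension.
Variables A C : zmodType.

Definition split_in (c : C) : C * A := (c, 0).

Fact split_in_additive : zmod_morphism split_in.
Proof. by move=> x y; congr (_, _); rewrite subr0. Qed.

HB.instance Definition _ :=
  Algebra.isZmodMorphism.Build C (C * A)%type split_in split_in_additive.

Definition split_out (e : C * A) : A := e.2.

Fact split_out_additive : zmod_morphism split_out.
Proof. by []. Qed.

HB.instance Definition _ :=
  Algebra.isZmodMorphism.Build (C * A)%type A split_out split_out_additive.

Fact split_in_inj : injective split_in.
Proof. by move=> x y []. Qed.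

Fact split_out_surj a : exists e, split_out e = a.
Proof. by exists (0, a). Qed.

Fact split_exact e : split_out e = 0 <-> exists c, split_in c = e.
Proof.
case: e => c a; split=> [/= -> | [c' [_ <-]] //].
by exists c.
Qed.

Definition split_extension : extension A C :=
  Extension split_in_inj split_out_surj split_exact.

End SplitExtension.

(* [Ext^1_Z(A, C) = 0] for the group of equivalence classes of extensions, whose
   zero element is the class of the split extension. *)
Definition Ext_eq0 (A C : zmodType) : Prop :=
  forall E : extension A C, ext_equiv E (split_extension A C).

Definition cotorsion (C : zmodType) : Prop :=
  forall F : zmodType, torsion_free F -> Ext_eq0 F C.

(* Main.v *)
From HB Require Import structures.
Require Import Defs.
From mathcomp Require Import all_boot all_order all_algebra.
From mathcomp Require Import all_classical.
From mathcomp Require Import ring.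
From mathcomp Require wochoice.

(* [F] is the group with generators [e_(i,n,nu)] and [y_(eta,n)], where [eta]
   ranges over the [k]-tuples of functions [nat -> lambda_k], and relations
     y_(eta,n) = m_n y_(eta,n+1) + sum_i e_(i,n,eta|(i,n)),
   where [eta|(i,n)] forgets the values of [eta_i] from [n] on, and [m_n >= 1] is
   read off [eta_0 n].

   If [Ext(F,C) = 0], every choice of constants [c_(eta,n)] in [C] added to the
   relations can be solved in [C]. Letting [eta_i n] code a [C]-valued function of
   [eta_0, ..., eta_(i-1)], which is possible because
   [lambda_i ^ aleph_0 = lambda_i] and [lambda_(i+1) = 2 ^ lambda_i], each [eta]
   guesses the values of the solution at the generators [e] it involves; choosing
   [eta_(k-1), ..., eta_0] in this order, some [eta] guesses right for every [n].
   Subtracting the guess from the constants, one can thus solve any system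
   [x_n = m_n x_(n+1) + c_n] in [C], which makes [C] cotorsion by extending
   partial retractions along rank-one torsion-free quotients.

   A subgroup of cardinality at most [aleph_(k-1)] only involves the tuples with
   coordinates in a set of at most [aleph_(k-1)] functions. For these tuples one
   can select a coordinate [l eta] such that the generators
   [e_(l eta, n, eta|(l eta, n))], [n] large, may be eliminated along a
   well-founded order. Hence the subgroup embeds in a free abelian group. *)

Set Implicit Arguments.
Unset Strict Implicit.
Unset Printing Implicit Defensive.

Import Order.TTheory GRing.Theory Num.Theory.

Local Open Scope classical_set_scope.
Local Open Scope card_scope.
Local Open Scope ring_scope.

(** * Free abelian groups *)

Section FreeAbelian.
Variable T : choiceType.

Definition finsupp : {pred T -> int} :=
  fun f => `[< finite_set [set t | f t <> 0] >].

Fact finsupp_zmod_closed : zmod_closed finsupp.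
Proof.
split=> [|f g /asboolP ff /asboolP fg]; apply/asboolP.
  by rewrite (_ : [set _ | _] = set0) //; apply/seteqP; split.
apply: sub_finite_set (_ : finite_set ([set t | f t <> 0] `|` [set t | g t <> 0])).
  move=> t /= fgt; case: (pselect (f t = 0)) => [f0|]; [right=> g0|by left].
  by apply: fgt; rewrite -[(f - g) t]/(f t - g t) f0 g0 subrr.
by rewrite finite_setU.
Qed.

HB.instance Definition _ :=
  GRing.isZmodClosed.Build (T -> int) finsupp finsupp_zmod_closed.

Record FA := MkFA { FAval :> T -> int; _ : FAval \in finsupp }.

HB.instance Definition _ := [isSub for FAval].
HB.instance Definition _ := [Choice of FA by <:].
HB.instance Definition _ := [SubChoice_isSubZmodule of FA by <:].

Lemma FA_fin (f : FA) : finite_set [set t | f t <> 0].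
Proof. by case: f => f /= /asboolP. Qed.

Lemma FAP (f g : FA) : f =1 g -> f = g.
Proof. by move=> fg; apply/val_inj/funext. Qed.

Lemma FA0 t : (0 : FA) t = 0. Proof. by []. Qed.
Lemma FAB (f g : FA) t : (f - g) t = f t - g t. Proof. by []. Qed.

Definition FAcoef t (f : FA) : int := f t.
Fact FAcoef_zmod t : zmod_morphism (FAcoef t). Proof. by []. Qed.
HB.instance Definition _ t :=
  Algebra.isZmodMorphism.Build FA int (FAcoef t) (FAcoef_zmod t).

Lemma FAMz (f : FA) (z : int) t : (f *~ z) t = f t * z.
Proof. by rewrite -[LHS]/(FAcoef t (f *~ z)) raddfMz mulrzz. Qed.

Lemma FA_sum (I : Type) (r : seq I) (P : pred I) (h : I -> FA) t :
  (\sum_(i <- r | P i) h i) t = \sum_(i <- r | P i) h i t.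
Proof. by rewrite -[LHS]/(FAcoef t _) raddf_sum. Qed.

Fact dirac_subproof (t : T) : (fun s : T => (s == t)%:Z) \in finsupp.
Proof.
apply/asboolP; apply: sub_finite_set (finite_set1 t) => s /=.
by case: eqP.
Qed.

Definition dirac t : FA := MkFA (dirac_subproof t).

Lemma diracE t s : dirac t s = (s == t)%:Z. Proof. by []. Qed.

(** The homomorphism on the free group with values [x] on the basis; only finitely many terms of the
    sum are nonzero. *)
Definition lift (V : zmodType) (x : T -> V) (f : FA) : V :=
  \sum_(t \in [set: T]) x t *~ f t.

Lemma liftE (V : zmodType) (x : T -> V) (f : FA) (A : set T) :
  [set t | f t <> 0] `<=` A -> lift x f = \sum_(t \in A) x t *~ f t.
Proof.
move=> fA; rewrite /lift -(fsbig_widen A [set: T]) // => t [_ At] /=.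
by case: (pselect (f t = 0)) => [->|/fA//]; rewrite mulr0z.
Qed.

Fact lift_zmod (V : zmodType) (x : T -> V) : zmod_morphism (lift x).
Proof.
move=> f g; pose A := [set t | f t <> 0] `|` [set t | g t <> 0].
have finA : finite_set A by rewrite finite_setU; split; exact: FA_fin.
have fA : [set t | f t <> 0] `<=` A by move=> t; left.
have gA : [set t | g t <> 0] `<=` A by move=> t; right.
have fgA : [set t | (f - g) t <> 0] `<=` A.
  move=> t /= fgt; case: (pselect (f t = 0)) => [f0|]; [right=> g0|by left].
  by apply: fgt; rewrite -[LHS]/(f t - g t) f0 g0.
rewrite (liftE x fA) (liftE x gA) (liftE x fgA).
apply: (addIr (\sum_(t \in A) x t *~ g t)); rewrite subrK -fsbig_split //=.
apply: eq_fsbigr => t _; rewrite -mulrzDr.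
by rewrite -[X in _ *~ X]/(f t - g t + g t) subrK.
Qed.
HB.instance Definition _ (V : zmodType) (x : T -> V) :=
  Algebra.isZmodMorphism.Build FA V (lift x) (lift_zmod x).

Lemma lift_dirac (V : zmodType) (x : T -> V) t : lift x (dirac t) = x t.
Proof.
rewrite (@liftE V x _ [set t]); first by rewrite fsbig_set1 /= eqxx.
by move=> s /=; case: eqP.
Qed.

Lemma lift_eq (V : zmodType) (x y : T -> V) (f : FA) :
  (forall t, f t <> 0 -> x t = y t) -> lift x f = lift y f.
Proof.
move=> xy; apply: eq_fsbigr => t _.
by have [->|/eqP/xy->] := eqVneq (f t) 0; rewrite ?mulr0z.
Qed.

Lemma raddf_lift (V U : zmodType) (h : {additive V -> U}) (x : T -> V) (f : FA) :
  h (lift x f) = lift (h \o x) f.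
Proof.
have ff := FA_fin f; have sub := @subset_refl _ [set t | f t <> 0].
rewrite (liftE x sub) (liftE (h \o x) sub) !fsbig_finite // raddf_sum.
by apply: eq_bigr => t _; rewrite raddfMz.
Qed.

Lemma lift_id (f : FA) : lift dirac f = f.
Proof.
apply: FAP => t; rewrite -[LHS]/(FAcoef t _) raddf_lift.
rewrite (@liftE _ _ _ ([set t] `|` [set s | f s <> 0])); last by right.
rewrite (fsbigD1 t) //=.
- rewrite /FAcoef /= eqxx fsbig1 ?addr0 ?mulrzz ?mul1r // => s [_ /= st].
  by case: eqP => [ts|]; [case: st|rewrite mul0rz].
- by rewrite finite_setU; split=> //; exact: FA_fin.
- by left.
Qed.

End FreeAbelian.

Section LiftClosed.
Variables (T : choiceType) (V : zmodType) (K : zmodClosed V).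

Lemma lift_closed (x : T -> V) (f : FA T) :
  (forall t, f t <> 0 -> x t \in K) -> lift x f \in K.
Proof.
move=> xK; rewrite (liftE x (@subset_refl _ _)) (fsbig_finite _ _ (FA_fin f)) /=.
rewrite big_seq; apply: rpred_sum => t; rewrite (in_fset_set (FA_fin f)) => /set_mem ft.
by rewrite rpredMz ?xK.
Qed.

End LiftClosed.

(** The elements satisfying [Q] form a subgroup that contains the basis. *)
Lemma FA_ind (T : choiceType) (Q : FA T -> Prop) :
  Q 0 -> (forall x y, Q x -> Q y -> Q (x - y)) -> (forall t, Q (dirac t)) ->
  forall f, Q f.
Proof.
move=> Q0 QB Qd f; pose q : {pred FA T} := fun x => `[< Q x >].
have q_closed : zmod_closed q.
  by split=> [|x y /asboolP Qx /asboolP Qy]; apply/asboolP; [|exact: QB].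
pose qc := GRing.isZmodClosed.Build _ q q_closed.
pose qz : zmodClosed (FA T) := HB.pack q qc.
suff : f \in qz by move/asboolP.
by rewrite -(lift_id f); apply: lift_closed => t _; exact/asboolP.
Qed.

(** * Extending homomorphisms when Ext vanishes *)

Section ExtendHom.
Variables (P C : zmodType) (K : zmodClosed P) (psi : P -> C).
Hypothesis psiB : {in K &, {morph psi : x y / x - y}}.

Let psi0 : psi 0 = 0.
Proof. by have := psiB (rpred0 K) (rpred0 K); rewrite !subrr. Qed.

(** Dividing [C * P] by this subgroup gives the pushout of [psi] and the inclusion of [K] in [P]. *)
Definition antigraph : {pred C * P} :=
  fun z => (z.2 \in K) && (z.1 == - psi z.2).

Fact antigraph_zmod_closed : zmod_closed antigraph.
Proof.
split=> [|[c x] [d y]]; rewrite ?unfold_in.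
  by apply/andP; split; [exact: (rpred0 K)|apply/eqP; rewrite psi0 oppr0].
move=> /andP[/= Kx /eqP->] /andP[/= Ky /eqP->]; apply/andP; split=> /=.
  exact: rpredB.
by rewrite psiB // opprB opprK addrC.
Qed.

HB.instance Definition _ :=
  GRing.isZmodClosed.Build (C * P)%type antigraph antigraph_zmod_closed.

Local Notation G := (Quotient.quot antigraph).
Local Notation F := (Quotient.quot K).

Let piG (z : (C * P)%type) : G := \pi_G%qT z.
Let piF (x : P) : F := \pi_F%qT x.

Let piG_eq z w : piG z = piG w <-> z - w \in antigraph.
Proof. by rewrite Quotient.idealrBE; split=> [/eqP|/eqP]. Qed.

Let piF_eq x y : piF x = piF y <-> x - y \in K.
Proof. by rewrite Quotient.idealrBE; split=> [/eqP|/eqP]. Qed.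

Let piGB z w : piG (z - w) = piG z - piG w.
Proof. by rewrite /piG raddfB. Qed.
Let piFB z w : piF (z - w) = piF z - piF w.
Proof. by rewrite /piF raddfB. Qed.

Let push_in (c : C) : G := piG (c, 0).
Let push_out (g : G) : F := piF (repr g).2.

Let push_outE z : push_out (piG z) = piF z.2.
Proof.
apply/piF_eq; have: repr (piG z) - z \in antigraph.
  by apply/piG_eq; rewrite /piG reprK.
by rewrite unfold_in => /andP[].
Qed.

Fact push_in_zmod : zmod_morphism push_in.
Proof. by move=> c d; rewrite /push_in -piGB; congr piG; congr (_, _); rewrite subr0. Qed.
HB.instance Definition _ := Algebra.isZmodMorphism.Build C G push_in push_in_zmod.

Fact push_out_zmod : zmod_morphism push_out.
Proof.
move=> g h; rewrite -(reprK g) -(reprK h) -!/(piG _) -piGB !push_outE.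
by rewrite -piFB.
Qed.
HB.instance Definition _ := Algebra.isZmodMorphism.Build G F push_out push_out_zmod.

Fact push_in_inj : injective push_in.
Proof.
move=> c d /piG_eq; rewrite unfold_in /= subrr psi0 oppr0 => /andP[_].
by rewrite subr_eq0 => /eqP.
Qed.

Fact push_out_surj a : exists g, push_out g = a.
Proof. by exists (piG (0, repr a)); rewrite push_outE /piF reprK. Qed.

Fact push_exact g : push_out g = 0 <-> exists c, push_in c = g.
Proof.
rewrite -(reprK g) -/(piG _); case: (repr g) => c x; rewrite push_outE /=.
have -> : 0 = piF 0 by rewrite -(subrr 0) piFB subrr.
split=> [/piF_eq|[d /piG_eq]].
  rewrite subr0 => Kx; exists (c + psi x); apply/piG_eq.
  rewrite unfold_in /= sub0r rpredN Kx /=.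
  have -> : psi (- x) = - psi x by rewrite -sub0r psiB ?rpred0 // psi0 sub0r.
  by rewrite opprK addrAC subrr add0r.
by rewrite unfold_in /= sub0r rpredN => /andP[Kx _]; apply/piF_eq; rewrite subr0.
Qed.

(** The pushout along [psi] is an extension of [P / K] by [C], hence splits; the map from [P] to it
    followed by the retraction onto [C] extends [psi]. *)
Lemma Ext_quot_extend : Ext_eq0 F C ->
  exists Psi : {additive P -> C}, {in K, Psi =1 psi}.
Proof.
case/(_ (Extension push_in_inj push_out_surj push_exact)) => phi [phi_in _].
have Psi_zmod : zmod_morphism (fun x => (phi (piG (0, x))).1).
  move=> x y; have -> : (0, x - y) = (0, x) - (0, y) :> C * P.
    by congr (_, _); rewrite subrr.
  by rewrite piGB raddfB.
pose Psi := GRing.isZmodMorphism.Build _ _ _ Psi_zmod.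
pose PsiA : {additive P -> C} := HB.pack (fun x => (phi (piG (0, x))).1) Psi.
exists PsiA => x Kx /=; have -> : piG (0, x) = push_in (psi x).
  by apply/piG_eq; rewrite unfold_in /= sub0r subr0 Kx /=.
by have /= -> := phi_in (psi x).
Qed.

End ExtendHom.

(** * Cardinals up to aleph_j *)

Lemma card_le_injP T U (A : set T) (B : set U) : B !=set0 ->
  A #<= B <-> exists f : T -> U,
    (forall x, A x -> B (f x)) /\
    (forall x y, A x -> A y -> f x = f y -> x = y).
Proof.
move=> [b Bb]; split=> [/card_leP[g]|[f [fAB finj]]].
  have gB x (Ax : A x) : B (set_val (g (SigSub (mem_set Ax)))).
    exact: (set_mem (valP (g (SigSub (mem_set Ax))))).
  pose f x := if pselect (A x) is left Ax
    then (set_val (g (SigSub (mem_set Ax))) : U) else b.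
  exists f; split=> [x Ax|x y Ax Ay]; rewrite /f.
    by case: pselect => // Ax'; apply: gB.
  case: pselect => // Ax'; case: pselect => // Ay' /val_inj.
  by move=> /(inj (in_setT _) (in_setT _)) [].
have : $|{injfun A >-> B}|.
  apply/injfunPex; exists f => // x y /set_mem Ax /set_mem Ay; exact: finj.
by case=> h; exact: inj_card_le.
Qed.

Lemma card_le_inj T U (A : set T) (B : set U) (f : T -> U) :
  (forall x, A x -> B (f x)) ->
  (forall x y, A x -> A y -> f x = f y -> x = y) -> A #<= B.
Proof.
move=> fAB finj; have [->//|/set0P[a Aa]] := eqVneq A set0.
apply/card_le_injP; first by exists (f a); exact: fAB.
by exists f.
Qed.

Lemma card_leT_injP T U : inhabited U ->
  [set: T] #<= [set: U] <-> exists f : T -> U, injective f.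
Proof.
move=> [u]; rewrite card_le_injP; last by exists u.
split=> [[f [_ finj]]|[f finj]]; exists f; first by move=> x y; exact: finj.
by split=> // x y _ _; exact: finj.
Qed.

Lemma card_le_surj T U (A : set T) (B : set U) (f : T -> U) :
  (forall y, B y -> exists2 x, A x & f x = y) -> B #<= A.
Proof.
move=> fsurj; apply: card_le_trans (card_image_le f A).
by apply: subset_card_le => y /fsurj[x Ax <-]; exists x.
Qed.

Record strict_wo (T : Type) (R : T -> T -> Prop) : Prop := StrictWo {
  wo_wf : well_founded R;
  wo_trans : forall x y z, R x y -> R y z -> R x z;
  wo_total : forall x y, x = y \/ R x y \/ R y x }.

Lemma wf_irrefl T (R : T -> T -> Prop) : well_founded R -> forall x, ~ R x x.
Proof. by move=> wfR x; elim: (wfR x) => y _ IH Ryy; exact: (IH _ Ryy Ryy). Qed.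

Lemma wf_preimage T U (f : T -> U) (R : U -> U -> Prop) :
  well_founded R -> well_founded (fun x y => R (f x) (f y)).
Proof.
move=> wfR x; move E: (f x) => u; elim: (wfR u) x E => {}u _ IH x E.
by split=> y; rewrite E => /IH; apply.
Qed.

Lemma wf_sub T (R S : T -> T -> Prop) :
  (forall x y, S x y -> R x y) -> well_founded R -> well_founded S.
Proof.
by move=> SR wfR x; elim: (wfR x) => {}x _ IH; split=> y /SR; exact: IH.
Qed.

Lemma ltn_wf : well_founded (fun m n : nat => (m < n)%N).
Proof. by move=> n; elim/ltn_ind: n => n IH; split. Qed.

Lemma strict_wo_exists (T : Type) : exists R : T -> T -> Prop, strict_wo R.
Proof.
have [R0 woR] := wochoice.well_ordering_principle ({classic T} : eqType).
pose S (x y : T) := x <> y /\ R0 x y.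
have least (P : T -> Prop) x : P x -> exists z, P z /\ forall y, P y -> R0 z y.
  move=> Px; pose A : pred T := fun x => `[< P x >].
  have [|z [[Az Rz] _]] := woR A; first by exists x; apply/asboolP.
  by exists z; split; [exact/asboolP|move=> y Py; apply: Rz; apply/asboolP].
have woT : wochoice.wo_chain R0 predT by exact: wochoice.withinW woR.
have anti x y : R0 x y -> R0 y x -> x = y.
  by move=> xy yx; apply: (wochoice.wo_chain_antisymmetric woT) => //; rewrite xy yx.
have tot x y : x = y \/ S x y \/ S y x.
  have [|nxy] := pselect (x = y); first by left.
  by have /orP[xy|yx] := wochoice.wo_chainW woT (erefl : x \in predT) (erefl : y \in predT);
    right; [left|right]; split=> // yx'; apply: nxy.
exists S; split; [|move: tot => _|exact: tot].
  move=> x; apply: contrapT => Nx; have [z [Nz zmin]] := least (fun x => ~ Acc S x) x Nx.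
  apply: Nz; split=> y [nyz Ryz].
  by apply: contrapT => Ny; apply: nyz; apply: anti => //; exact: zmin.
move=> x y z [nxy Rxy] [nyz Ryz].
(* Transitivity: the [R0]-least among [x], [y], [z] can only be [x]. *)
have [w [Pw wmin]] := least (fun w => [\/ w = x, w = y | w = z]) x (Or31 _ _ erefl).
have wx := wmin x (Or31 _ _ erefl).
have wy := wmin y (Or32 _ _ erefl).
have wz := wmin z (Or33 _ _ erefl).
have wE : w = x.
  case: Pw => // wE; first by case: nxy; apply: anti => //; rewrite -wE.
  by case: nyz; apply: anti => //; rewrite -wE.
by rewrite wE in wz; split=> // xz; apply: nxy; apply: anti => //; rewrite xz.
Qed.

(** This expresses that |X| is at most aleph_j: some well-order of [X] has all its proper initial
    segments of cardinality at most aleph_(j-1). *)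
Fixpoint small (j : nat) (T : Type) (X : set T) : Prop :=
  if j is i.+1 then
    exists R : T -> T -> Prop,
      [/\ well_founded R, (forall x y z, R x y -> R y z -> R x z),
          (forall x y, X x -> X y -> x = y \/ R x y \/ R y x) &
          forall x, X x -> small i (X `&` [set y | R y x])]
  else countable X.

Lemma small0 j T : small j (@set0 T).
Proof.
case: j => [|j]; first exact: countable0.
by have [R [? ? ?]] := strict_wo_exists T; exists R; split.
Qed.

Lemma small_le (j : nat) T U (X : set T) (Y : set U) :
  X #<= Y -> small j Y -> small j X.
Proof.
elim: j T U X Y => [|j IH] T U X Y XY /=; first exact: sub_countable.
have [->|/set0P[x0 Xx0]] := eqVneq X set0; first by move=> _; exact: (small0 j.+1).
have Y0 : Y !=set0.
  apply/set0P; apply: contraTN XY => /eqP->.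
  by rewrite card_le0; apply/set0P; exists x0.
move: XY; rewrite card_le_injP // => -[f [fXY finj]] [R [wfR trR totR segR]].
exists (fun a b => R (f a) (f b)); split.
- exact: wf_preimage.
- by move=> x y z; exact: trR.
- move=> x y Xx Xy; have [/finj->//|] := totR _ _ (fXY _ Xx) (fXY _ Xy); first by left.
  by right.
- move=> x Xx; apply: IH (segR _ (fXY _ Xx)).
  apply: (card_le_inj (f := f)) => [y [Xy Ryx]|y z [Xy _] [Xz _]].
    by split; first exact: fXY.
  exact: finj.
Qed.

Lemma small_sub j T (X Y : set T) : X `<=` Y -> small j Y -> small j X.
Proof. by move/subset_card_le; exact: small_le. Qed.

Lemma countable_small j T (X : set T) : countable X -> small j X.
Proof.
elim: j X => [//|j IH] X cX; have [f finj] := countable_injP _ cX.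
exists (fun a b => f a < f b)%N; split.
- exact: wf_preimage ltn_wf.
- by move=> x y z; exact: ltn_trans.
- move=> x y Xx Xy; case: (ltngtP (f x) (f y)) => [|| /finj E].
    by right; left.
    by right; right.
  by left; apply: E; exact/mem_set.
- by move=> x _; apply: IH; apply: sub_countable cX; apply: subset_card_le => y [].
Qed.

Lemma small_setU1 j T (X : set T) x : small j X -> small j (X `|` [set x]).
Proof.
elim: j X => [|j IH] X /=.
  move=> cX; rewrite (_ : _ `|` _ = \bigcup_(b in [set: bool]) if b then X else [set x]).
    by apply: bigcup_countable => // -[] _ //; exact: countable1.
  apply/seteqP; split=> [y [Xy|->]|y [[] _ ?]]; [by exists true|by exists false|by left|by right].
move=> [R [wfR trR totR segR]].
(* The point [x] is put at the bottom, so each initial segment gains at most [x]. *)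
pose R' a b := b <> x /\ (a = x \/ R a b).
have Accx : Acc R' x by split=> y [].
exists R'; split.
- move=> b; elim: (wfR b) => {}b _ IHb; split=> a [_ [->//|]]; exact: IHb.
- move=> a b c [nb ab] [nc [//|bc]]; split=> //; case: ab => [|ab]; first by left.
  by right; exact: trR bc.
- have xl y : y = x \/ R' x y.
    by have [|nyx] := pselect (y = x); [left|right; split=> //; left].
  move=> a b Ua Ub; have [->|xa] := xl a; first by have [->|] := xl b; [left|right; left].
  have [->|xb] := xl b; first by right; right.
  have Xa : X a by case: Ua => // ax; case: xa.
  have Xb : X b by case: Ub => // bx; case: xb.
  have [->|[ab|ba]] := totR _ _ Xa Xb; [by left|right; left|right; right].
    by split; [case: xb|right].
  by split; [case: xa|right].
- move=> b Ub; have [bx|nbx] := pselect (b = x).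
    by apply: small_sub (small0 j T) => y [_ []].
  have Xb : X b by case: Ub.
  apply: small_sub (IH _ (segR b Xb)) => a [Ua [_ [->|Rab]]]; first by right.
  by case: Ua => [Xa|->]; [left|right].
Qed.

(** In the lexicographic order, the segment below [(x, n)] lies in the product with [nat] of the
    segment below [x] enlarged by [x]. *)
Lemma small_setX_nat j T (X : set T) : small j X -> small j (X `*` [set: nat]).
Proof.
elim: j X => [|j IH] X /=; first by move=> cX; apply: countableX.
move=> [R [wfR trR totR segR]].
exists (fun a b => R a.1 b.1 \/ a.1 = b.1 /\ (a.2 < b.2)%N); split.
- move=> [x n]; elim: (wfR x) n => {}x _ IHx n.
  elim/ltn_ind: n => n IHn; split=> -[y m] /= [Ryx|[-> mn]]; first exact: IHx.
  exact: IHn.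
- move=> [x m] [y n] [z p] /= [xy|[-> mn]] [yz|[<- np]]; try by left => //; exact: trR yz.
  by right; split=> //; exact: ltn_trans np.
- move=> [x m] [y n] [/= Xx _] [/= Xy _].
  have [->|[xy|yx]] := totR _ _ Xx Xy; [|by right; left; left|by right; right; left].
  by case: (ltngtP m n) => [mn|nm|->]; [right; left; right|right; right; right|left].
- move=> [x n] [/= Xx _]; apply: small_sub (IH _ (small_setU1 x (segR x Xx))).
  by move=> [y m] [[/= Xy _] [Ryx|[-> _]]]; split=> //; [left|right].
Qed.

(** In a well-order of [S], segments smaller than [S] are small by induction. If some segment is as
    large as [S], the least such one replaces [S]. *)
Lemma is_aleph_small j S : is_aleph j S -> small j [set: S].
Proof.
elim: j S => [S /= /card_eqPle[]//|j IH S /= [S' [alS' [ltS' succS]]]].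
have [R [wfR trR totR]] := strict_wo_exists S.
have seg_small x : ~ ([set: S] #<= [set y | R y x]) -> small j [set y | R y x].
  move=> /negP nle; apply: small_le (IH _ alS'); apply: succS.
  by rewrite /card_lt card_leT.
have [[x0 bad0]|nobad] := pselect (exists x, [set: S] #<= [set y | R y x]); last first.
  exists R; split=> // x _; rewrite setTI; apply: seg_small => bad.
  by apply: nobad; exists x.
have [x [bad xmin]] : exists x, ([set: S] #<= [set y | R y x]) /\
    forall y, R y x -> ~ ([set: S] #<= [set z | R z y]).
  elim: (wfR x0) bad0 => x _ IHx bad.
  have [[y [Ryx bady]]|ny] := pselect (exists y, R y x /\ ([set: S] #<= [set z | R z y])).
    exact: IHx bady.
  by exists x; split=> // y Ryx bady; apply: ny; exists y.
apply: (small_le (j := j.+1) bad); exists R; split=> // y Ryx.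
by apply: small_sub (seg_small _ (xmin _ Ryx)) => z [].
Qed.

Lemma seq_argmax (A : eqType) T (R : T -> T -> Prop) (key : A -> T) (s : seq A) a :
  (forall x y z, R x y -> R y z -> R x z) ->
  {in s &, forall x y, key x = key y \/ R (key x) (key y) \/ R (key y) (key x)} ->
  a \in s -> exists2 x, x \in s & {in s, forall y, key y = key x \/ R (key y) (key x)}.
Proof.
move=> trR; elim: s a => // b [|c s] IH a totR _.
  by exists b => [|y]; rewrite !inE // => /eqP->; left.
have [||x xs xmax] := IH c; first by move=> y z ys zs; apply: totR; rewrite inE ?ys ?zs orbT.
  by rewrite inE eqxx.
have bs : b \in b :: c :: s by rewrite inE eqxx.
have xs' : x \in b :: c :: s by rewrite inE xs orbT.
have [bx|xb] : (key b = key x \/ R (key b) (key x)) \/ R (key x) (key b).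
- by have [|[]] := totR b x bs xs'; [left; left|left; right|right].
- by exists x => // y; rewrite inE => /orP[/eqP->//|]; exact: xmax.
exists b => // y; rewrite inE => /orP[/eqP->|/xmax[->|yx]]; [by left|by right|right].
exact: trR xb.
Qed.

(** * Well-founded dependencies between tuples *)

Section Dependency.
Variables (k : nat) (L : Type).
Local Notation Lam := ('I_k -> nat -> L).
Implicit Types (eta theta : Lam) (X : set (nat -> L)).

(** Equality of the restrictions at [(l, n)], which forget coordinate [l] from [n] on. *)
Definition agree (l : 'I_k) (n : nat) eta theta : Prop :=
  (forall i, i != l -> eta i = theta i) /\
  (forall t, (t < n)%N -> eta l t = theta l t).

Definition coords_in X : set Lam := [set eta | forall i, X (eta i)].

(* The relators at [eta] involve a generator eliminated by means of [theta]. *)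
Definition dep X (l : Lam -> 'I_k) (n0 : Lam -> nat) theta eta : Prop :=
  [/\ coords_in X theta, coords_in X eta, theta <> eta &
      exists n, (n0 theta <= n)%N /\ agree (l theta) n theta eta].

Lemma eventually_disagree (l : 'I_k) eta theta : eta <> theta ->
  exists N, forall n, (N <= n)%N -> ~ agree l n eta theta.
Proof.
move=> neq.
have [[t nt]|ot] := pselect (exists t, eta l t <> theta l t).
  by exists t.+1 => n tn [_ /(_ t tn)].
exists 0%N => n _ [off _]; apply: neq; apply/funext => i.
have [->|il] := eqVneq i l; last exact: off.
by apply/funext => t; apply: contrapT => nt; apply: ot; exists t.
Qed.

(** Tuples over [X] are numbered, and [n0 eta] is taken so large that [eta] is already separated
    from the finitely many tuples of smaller number. Dependencies then increase the number. *)
Lemma dep_wf_countable X (l : Lam -> 'I_k) : countable X ->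
  exists n0, well_founded (dep X l n0).
Proof.
move=> /countable_injP[c cinj].
pose code eta : nat := choice.pickle [ffun i => c (eta i)].
have codeI eta theta : coords_in X eta -> coords_in X theta ->
    code eta = code theta -> eta = theta.
  move=> Xe Xt /(pcan_inj choice.pickleK)/ffunP E; apply/funext => i.
  by have := E i; rewrite !ffunE; apply: cinj; apply/mem_set.
have sep eta m : exists N, forall theta, coords_in X theta ->
    (code theta < m)%N -> eta <> theta ->
    forall n, (N <= n)%N -> ~ agree (l eta) n eta theta.
  elim: m => [|m [N HN]]; first by exists 0%N.
  have [[th [Xth cth neq]]|no] := pselect (exists theta,
      [/\ coords_in X theta, code theta = m & eta <> theta]); last first.
    exists N => th Xth; rewrite ltnS leq_eqVlt => /orP[/eqP E|] neq; last exact: HN.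
    by case: no; exists th.
  have [N' HN'] := eventually_disagree (l eta) neq.
  exists (maxn N N') => th' Xth'; rewrite ltnS leq_eqVlt => /orP[/eqP E|lt] neq' n.
    rewrite geq_max => /andP[_ N'n]; rewrite -(codeI th th') ?E //; exact: HN'.
  by rewrite geq_max => /andP[Nn _]; apply: HN.
have /choice[n0 Hn0] : forall eta, exists N, forall theta, coords_in X theta ->
    (code theta < code eta)%N -> eta <> theta ->
    forall n, (N <= n)%N -> ~ agree (l eta) n eta theta.
  by move=> eta; exact: sep.
exists n0; apply: wf_sub (wf_preimage code ltn_wf).
move=> theta eta [Xth Xeta neq [n [n0n agr]]].
case: ltngtP => // [lt|E]; first by case: (Hn0 theta eta Xeta lt neq n n0n agr).
by case: neq; exact: codeI.
Qed.

Lemma argmax_exists X (R : (nat -> L) -> (nat -> L) -> Prop) (i1 : 'I_k) eta :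
  (forall x y z, R x y -> R y z -> R x z) ->
  (forall x y, X x -> X y -> x = y \/ R x y \/ R y x) ->
  coords_in X eta -> exists i0, forall i, eta i = eta i0 \/ R (eta i) (eta i0).
Proof.
move=> trR totR Xeta; have i1e : i1 \in enum 'I_k by rewrite mem_enum.
have [|i0 _ Hi0] := seq_argmax trR _ i1e (key := eta).
  by move=> i i' _ _; exact: totR.
by exists i0 => i; apply: Hi0; rewrite mem_enum.
Qed.

(* Elements of [X] are ranked by a well-order with initial segments of smaller
   cardinality, and a tuple by its largest coordinate. Forbidding [l eta] to be
   the position of that coordinate makes the rank nonincreasing along
   dependencies, and within a given rank the induction hypothesis applies. *)
Lemma dep_wf j X (u : Lam -> {set 'I_k}) : small j X ->
  (forall eta, (j < #|u eta|)%N) ->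
  exists l n0, (forall eta, coords_in X eta -> l eta \in u eta) /\
    well_founded (dep X l n0).
Proof.
elim: j X u => [|j IH] X u.
  move=> cX u0; have /choice[l lu] eta : exists l, l \in u eta.
    by apply/set0Pn; rewrite -card_gt0.
  have [n0 wf] := dep_wf_countable l cX.
  by exists l, n0; split.
move=> [R [wfR trR totR segR]] u0.
have /choice[am amP] eta : exists i0, coords_in X eta ->
    forall i, eta i = eta i0 \/ R (eta i) (eta i0).
  have /set0Pn[i1 _] : u eta != finset.set0.
    by rewrite -card_gt0; exact: leq_ltn_trans (u0 eta).
  have [Xeta|nX] := pselect (coords_in X eta); last by exists i1.
  by have [i0 Hi0] := argmax_exists i1 trR totR Xeta; exists i0.
pose rk eta := eta (am eta).
pose seg x := (X `&` [set y | R y x]) `|` [set x].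
(* Giving up one position is affordable: more than [j.+1] were allowed, and the induction hypothesis
   asks for more than [j]. *)
pose u' eta := (u eta :\ am eta)%SET.
have u'0 eta : (j < #|u' eta|)%N.
  have := u0 eta; rewrite (cardsD1 (am eta)) -/(u' eta).
  by case: (_ \in _); rewrite ?add0n => //; apply: ltnW.
have /choice[lx lxP] x : exists l, exists n0, X x ->
    (forall eta, coords_in (seg x) eta -> l eta \in u' eta) /\
    well_founded (dep (seg x) l n0).
  have [Xx|nX] := pselect (X x); last by exists am, (fun=> 0%N).
  by have [l [n0 H]] := IH (seg x) u' (small_setU1 x (segR x Xx)) u'0; exists l, n0.
have /choice[nx nxP] := lxP.
pose l eta := lx (rk eta) eta; pose n0 eta := nx (rk eta) eta.
have rkX eta : coords_in X eta -> X (rk eta) by exact.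
have segX eta : coords_in X eta -> coords_in (seg (rk eta)) eta.
  by move=> Xeta i; have [->|Ri] := amP _ Xeta i; [right|left].
have lu' eta : coords_in X eta -> l eta \in u' eta.
  by move=> Xeta; have [+ _] := nxP _ (rkX _ Xeta); apply; exact: segX.
exists l, n0; split=> [eta Xeta|].
  by have := lu' _ Xeta; rewrite in_setD1 => /andP[].
have depE theta eta : dep X l n0 theta eta -> R (rk theta) (rk eta) \/
    rk theta = rk eta /\ dep (seg (rk eta)) (lx (rk eta)) (nx (rk eta)) theta eta.
  move=> [Xth Xeta neq [n [n0n agr]]].
  (* The tuples agree off [l theta], which is not [am theta], so the largest coordinate of [theta]
     occurs in [eta] too. *)
  have E : rk theta = eta (am theta).
    apply: (agr.1); have := lu' _ Xth; rewrite in_setD1 => /andP[+ _].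
    by rewrite eq_sym.
  have [E'|] := amP _ Xeta (am theta); last by rewrite -E; left.
  have Erk : rk theta = rk eta by rewrite E.
  right; split=> //; split=> //; [by rewrite -Erk; exact: segX|exact: segX|].
  by exists n; rewrite -Erk.
move=> eta; move E : (rk eta) => r; elim: (wfR r) eta E => {}r _ IHr eta E.
have [Xr|nXr] := pselect (X r); last first.
  by split=> theta [_ Xeta]; case: nXr; rewrite -E; exact: rkX.
have [_ wfr] := nxP _ Xr.
elim: (wfr eta) E => {}eta _ IHeta E.
by split=> theta /depE; rewrite E => -[/IHr/(_ _ erefl)//|[E' dp]]; exact: IHeta.
Qed.

End Dependency.

(** * The group and its small subgroups *)

Section Presentation.
Variables (k : nat) (L : choiceType) (x0 : L).
Local Notation Lam := ('I_k -> nat -> L).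
Variable m : Lam -> nat -> nat.
Implicit Types (eta theta : Lam).

(** The restriction at [(i, n)], kept a total tuple by overwriting the forgotten values with the
    default [x0]. *)
Definition trunc (i : 'I_k) (n : nat) eta : Lam :=
  fun j t => if (j == i) && (n <= t)%N then x0 else eta j t.

Lemma trunc_agree i n eta theta :
  trunc i n eta = trunc i n theta <-> agree i n eta theta.
Proof.
split=> [E|[off low]].
  split=> [j ji|t tn].
    by have := congr1 (fun h => h j) E; rewrite /trunc (negbTE ji).
  by have := congr1 (fun h => h i t) E; rewrite /trunc eqxx leqNgt tn.
apply/funext => j; apply/funext => t; rewrite /trunc.
have [->|ji] /= := eqVneq j i; last by rewrite off.
by case: leqP => // /low.
Qed.

Lemma agree_sym i n eta theta : agree i n eta theta -> agree i n theta eta.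
Proof. by rewrite -!trunc_agree. Qed.

Definition gens : Type := (('I_k * nat * Lam) + (Lam * nat))%type.
HB.instance Definition _ := Choice.on gens.
Definition egen (i : 'I_k) n eta : gens := inl (i, n, eta).
Definition ygen eta n : gens := inr (eta, n).
Definition egens i n eta : FA gens := dirac (egen i n eta).
Definition ygens eta n : FA gens := dirac (ygen eta n).

Definition relator (z : Lam * nat) : FA gens :=
  ygens z.1 z.2 - ygens z.1 z.2.+1 *~ (m z.1 z.2).+1
  - \sum_(i < k) egens i z.2 (trunc i z.2 z.1).

Local Notation rels := (lift relator).

Lemma ygen_eq eta n eta' n' : (ygen eta n == ygen eta' n') = ((eta', n') == (eta, n)).
Proof. by apply/eqP/eqP => -[-> ->]. Qed.

Lemma relator_coef z eta n : relator z (ygen eta n) =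
  (z == (eta, n))%:Z - ((z.1, z.2.+1) == (eta, n))%:Z * (m z.1 z.2).+1.
Proof.
rewrite /relator !FAB FAMz FA_sum big1 ?subr0 // /ygens !diracE.
by case: z => eta' n'; rewrite !ygen_eq.
Qed.

Lemma rels_coef0 z eta : rels z (ygen eta 0) = z (eta, 0%N).
Proof.
elim/FA_ind: z => [|x y IHx IHy|t]; first by rewrite raddf0.
  by rewrite raddfB !FAB IHx IHy.
by rewrite lift_dirac relator_coef diracE [(eta, _) == _]eq_sym xpair_eqE andbF mul0r subr0.
Qed.

Lemma rels_coefS z eta n :
  rels z (ygen eta n.+1) = z (eta, n.+1) - z (eta, n) * (m eta n).+1.
Proof.
elim/FA_ind: z => [|x y IHx IHy|[eta' n']]; first by rewrite raddf0 !FA0 mul0r subr0.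
  by rewrite raddfB !FAB IHx IHy; ring.
rewrite lift_dirac relator_coef !diracE /= !xpair_eqE eqSS (eq_sym eta eta')
  [n.+1 == _]eq_sym [n == _]eq_sym.
by have [->|_] := eqVneq eta' eta; have [->|_] := eqVneq n' n; rewrite ?andbF ?mul0r.
Qed.

(** The relators are triangular with respect to the [ygen] coordinates, so their coefficients vanish
    one after the other. Relators at [eta] thus occur only if some [ygen eta n] does. *)
Lemma rels_supp z eta : (forall n, rels z (ygen eta n) = 0) -> forall n, z (eta, n) = 0.
Proof.
move=> r0; elim=> [|n IHn]; first by rewrite -rels_coef0.
by have := r0 n.+1; rewrite rels_coefS IHn mul0r subr0.
Qed.

Lemma rels_inj : injective rels.
Proof.
move=> z w zw; apply/eqP; rewrite -subr_eq0; apply/eqP; apply: FAP => -[eta n].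
by apply: rels_supp => {}n; rewrite raddfB /= zw subrr.
Qed.

Definition relK : {pred FA gens} := fun x => `[< exists z, rels z = x >].

Fact relK_zmod_closed : zmod_closed relK.
Proof.
split=> [|_ _ /asboolP[z <-] /asboolP[w <-]]; apply/asboolP.
  by exists 0; rewrite raddf0.
by exists (z - w); rewrite raddfB.
Qed.
HB.instance Definition _ :=
  GRing.isZmodClosed.Build (FA gens) relK relK_zmod_closed.

Lemma relator_relK z : relator z \in relK.
Proof. by apply/asboolP; exists (dirac z); rewrite lift_dirac. Qed.

Definition mod_rel : zmodType := Quotient.quot relK.

End Presentation.

Lemma wf_rec (A V : Type) (R : A -> A -> Prop)
    (G : forall x, (forall y, R y x -> V) -> V) :
  well_founded R -> exists f : A -> V, forall x, f x = G x (fun y _ => f y).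
Proof.
move=> wfR; exists (Fix wfR (fun=> V) G) => x; rewrite Fix_eq // => {}x f g fg.
by congr (G x); do 2![apply: functional_extensionality_dep => ?].
Qed.

(** * Elimination of generators *)

Section Reduction.
Variables (k : nat) (L : choiceType) (x0 : L).
Local Notation Lam := ('I_k -> nat -> L).
Variables (m : Lam -> nat -> nat) (X : set (nat -> L)).
Variables (l : Lam -> 'I_k) (n0 : Lam -> nat).
Hypothesis wf_dep : well_founded (dep X l n0).

Local Notation trunc := (trunc x0).
Local Notation relator := (relator x0 m).
Local Notation relK := (relK x0 m).
Local Notation M eta n := (Posz (m eta n).+1).
Implicit Types (eta theta nu : Lam).

(* For [n >= n0 theta] the relator at [(theta, n)] serves to eliminate the
   generator [egens (l theta) n (trunc (l theta) n theta)]. *)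
Let eliminates theta i n nu :=
  [/\ coords_in X theta, (n0 theta <= n)%N, l theta = i & trunc i n theta = nu].

(** The tuple eliminating the generator [(i, n, nu)]; the default [nu] has no meaning. *)
Let elt i n nu := xget nu [set theta | eliminates theta i n nu].

Let elt_elim theta i n nu : eliminates theta i n nu -> eliminates (elt i n nu) i n nu.
Proof.
move=> el; apply: (@xgetPex _ nu [set theta | eliminates theta i n nu]).
by exists theta.
Qed.

Let elim_dep theta eta i n : coords_in X eta -> i != l eta ->
  eliminates theta i n (trunc i n eta) -> dep X l n0 theta eta.
Proof.
move=> Xeta il [Xth n0n lth /trunc_agree agr]; split=> //.
  by move=> E; rewrite -lth E eqxx in il.
by exists n; rewrite lth.
Qed.

(** Two distinct eliminating tuples would depend on each other, against well-foundedness. *)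
Let elim_uniq theta eta i n nu :
  eliminates theta i n nu -> eliminates eta i n nu -> theta = eta.
Proof.
move=> [Xth tn lth <-] [Xeta en leta] /trunc_agree agr; apply: contrapT => neq.
have d1 : dep X l n0 theta eta.
  by split=> //; exists n; rewrite lth; split=> //; exact: agree_sym agr.
have d2 : dep X l n0 eta theta.
  by split=> // [/esym //|]; exists n; rewrite leta.
have cyc a : Acc (dep X l n0) a -> forall b, dep X l n0 a b -> dep X l n0 b a -> False.
  by elim=> {}a _ IH b ab ba; exact: (IH b ba a ba ab).
exact: cyc (wf_dep theta) _ d1 d2.
Qed.

(** The relator at [(eta, n)] solved for its generator at position [l eta]; those of the other
    generators that are themselves eliminated are replaced by their values. The test on [dep]
    supplies the proof that the recursive call requires. *)
Let step eta (rec : forall theta, dep X l n0 theta eta -> nat -> FA (gens k L)) n :=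
  ygens eta n - ygens eta n.+1 *~ M eta n -
  \sum_(i < k | i != l eta)
    if pselect (eliminates (elt i n (trunc i n eta)) i n (trunc i n eta) /\
                dep X l n0 (elt i n (trunc i n eta)) eta) is left p
    then rec _ (proj2 p) n else egens i n (trunc i n eta).

(** Such a [phi] rewrites elements within their class modulo the relations, in a way that
    trivializes all relators at tuples over [X]. Eliminated generators go to their values,
    [ygens eta n] is fixed from [n0 eta] on, and below [n0 eta] it is computed from the relators. *)
Lemma reduction_exists : exists phi : {additive FA (gens k L) -> FA (gens k L)},
  (forall x, phi x - x \in relK) /\
  (forall eta n, coords_in X eta -> phi (relator (eta, n)) = 0).
Proof.
have [val valE] := wf_rec step wf_dep.
pose phiE i n nu := if pselect (eliminates (elt i n nu) i n nu)
  then val (elt i n nu) n else egens i n nu.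
have val_eq eta n : coords_in X eta -> val eta n =
    ygens eta n - ygens eta n.+1 *~ M eta n -
    \sum_(i < k | i != l eta) phiE i n (trunc i n eta).
  move=> Xeta; rewrite valE /step; congr (_ - _); apply: eq_bigr => i il.
  rewrite /phiE; case: pselect => /= [[el _]|nel]; case: pselect => //.
  by move=> el; case: nel; split=> //; exact: elim_dep el.
have phiE_elim eta n : coords_in X eta -> (n0 eta <= n)%N ->
    phiE (l eta) n (trunc (l eta) n eta) = val eta n.
  move=> Xeta n0n; have el : eliminates eta (l eta) n (trunc (l eta) n eta) by split.
  rewrite /phiE; case: pselect => /= [el'|nel]; last by case: nel; exact: elt_elim el.
  exact: (congr1 (val^~ n) (elim_uniq el' el)).
(* By induction along dependencies: the difference is a relator corrected by differences of the same
   kind at smaller tuples. *)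
have val_relK eta n : coords_in X eta -> (n0 eta <= n)%N ->
    val eta n - egens (l eta) n (trunc (l eta) n eta) \in relK.
  move=> Xeta n0n; elim: (wf_dep eta) n Xeta n0n => {}eta _ IH n Xeta n0n.
  rewrite val_eq //.
  have -> : ygens eta n - ygens eta n.+1 *~ M eta n -
      \sum_(i < k | i != l eta) phiE i n (trunc i n eta) -
      egens (l eta) n (trunc (l eta) n eta) = relator (eta, n) -
      \sum_(i < k | i != l eta) (phiE i n (trunc i n eta) - egens i n (trunc i n eta)).
    rewrite /relator sumrB [in RHS](bigD1 (l eta)) //=.
    by rewrite opprB opprD !addrA subrK addrAC.
  rewrite rpredB ?relator_relK // rpred_sum // => i il.
  rewrite /phiE; case: pselect => /= [el|nel]; last by rewrite subrr rpred0.
  have [Xth n0th lth tr] := el; have := IH _ (elim_dep Xeta il el) n Xth n0th.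
  by rewrite lth tr.
have phiE_relK i n nu : phiE i n nu - egens i n nu \in relK.
  rewrite /phiE; case: pselect => /= [[Xth n0th lth tr]|nel]; last by rewrite subrr rpred0.
  by have := val_relK _ _ Xth n0th; rewrite lth tr.
(* [phiY eta d] is the image of the generator [y] of index [n0 eta - d], obtained by descending from
   [n0 eta]. *)
pose phiY := fix phiY eta d := if d is d'.+1 then
    phiY eta d' *~ M eta (n0 eta - d)%N +
    \sum_(i < k) phiE i (n0 eta - d)%N (trunc i (n0 eta - d)%N eta)
  else ygens eta (n0 eta).
have phiY_relK eta d : (d <= n0 eta)%N -> phiY eta d - ygens eta (n0 eta - d)%N \in relK.
  elim: d => [|d IHd] dn; first by rewrite subn0 subrr rpred0.
  have Sn : (n0 eta - d = (n0 eta - d.+1).+1)%N by rewrite subnSK.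
  have := IHd (ltnW dn); rewrite Sn /=; set n := (n0 eta - d.+1)%N => IH.
  have -> : phiY eta d *~ M eta n + \sum_(i < k) phiE i n (trunc i n eta) - ygens eta n =
      (phiY eta d - ygens eta n.+1) *~ M eta n +
      \sum_(i < k) (phiE i n (trunc i n eta) - egens i n (trunc i n eta)) -
      relator (eta, n).
    rewrite /relator /= sumrB mulrzBl [in RHS]addrACA -opprD.
    by rewrite -(addrA (ygens eta n)) -opprD opprB addrA subrK.
  rewrite rpredB ?relator_relK // rpredD ?rpredMz // rpred_sum // => i _.
  exact: phiE_relK.
pose phi0 (g : gens k L) := match g with
  | inl (i, n, nu) => phiE i n nu
  | inr (eta, n) => if (n0 eta <= n)%N then ygens eta n else phiY eta (n0 eta - n)%N
  end.
pose phi : {additive FA (gens k L) -> FA (gens k L)} := lift phi0.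
have phid t : phi (dirac t) = phi0 t by exact: lift_dirac.
have phie i n nu : phi (egens i n nu) = phiE i n nu by rewrite phid.
have phiy eta n : phi (ygens eta n) =
    if (n0 eta <= n)%N then ygens eta n else phiY eta (n0 eta - n)%N by rewrite phid.
exists phi; split.
  elim/FA_ind => [|x y Kx Ky|t]; first by rewrite raddf0 subrr rpred0.
    have -> : phi (x - y) - (x - y) = (phi x - x) - (phi y - y).
      by rewrite raddfB !opprD [LHS]addrACA.
    exact: rpredB.
  rewrite phid; case: t => [[[i n] nu]|[eta n]]; first exact: phiE_relK.
  rewrite /phi0; case: leqP => [n0n|nn0]; first by rewrite subrr rpred0.
  by have := phiY_relK eta (n0 eta - n)%N (leq_subr _ _); rewrite subKn // ltnW.
move=> eta n Xeta.
have -> : phi (relator (eta, n)) = phi (ygens eta n) - phi (ygens eta n.+1) *~ M eta n -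
    \sum_(i < k) phi (egens i n (trunc i n eta)).
  by rewrite /relator !(raddfB phi) (raddfMz phi) (raddf_sum phi).
rewrite !phiy.
rewrite (eq_bigr (fun i => phiE i n (trunc i n eta))); last by move=> i _; exact: phie.
case: leqP => [n0n|nn0].
  by rewrite (leqW n0n) (bigD1 (l eta)) //= phiE_elim // val_eq // subrK subrr.
(* At the boundary [n.+1 = n0 eta] both branches give [ygens eta (n0 eta)]. *)
have -> : (if (n0 eta <= n.+1)%N then ygens eta n.+1 else phiY eta (n0 eta - n.+1)%N) =
    phiY eta (n0 eta - n.+1)%N.
  case: leqP => // n0n; rewrite (eqP (n0n : n0 eta - n.+1 == 0)%N).
  by rewrite -[in LHS](@anti_leq (n0 eta) n.+1) // n0n nn0.
rewrite -{1}(subnSK nn0) /= subnSK // subKn ?(ltnW nn0) //.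
by rewrite -addrA -opprD subrr.
Qed.

End Reduction.

(** Terms with the same first component are merged, since [Zspan] attaches a single coefficient to
    each element. *)
Lemma Zspan_pairs (G : zmodType) (B : set G) (r : seq (G * int)) :
  (forall p, p \in r -> B p.1) -> Zspan B (\sum_(p <- r) p.1 *~ p.2).
Proof.
move=> rB; pose s := undup (map fst r).
pose c b := \sum_(p <- r | p.1 == b) p.2.
exists s, c; split=> [b|].
  by rewrite mem_undup => /mapP[p pr ->]; exact: rB.
transitivity (\sum_(b <- s) \sum_(p <- r | p.1 == b) p.1 *~ p.2); last first.
  apply: eq_bigr => b _; rewrite /c -[RHS]/(( *~%R b) _) raddf_sum.
  by apply: eq_bigr => p /eqP->.
rewrite [RHS](exchange_big_dep predT) //= big_seq [RHS]big_seq; apply: eq_bigr => p pr.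
rewrite -big_filter (eq_filter (a2 := pred1 p.1)) => [|b]; last exact: eq_sym.
by rewrite filter_pred1_uniq ?undup_uniq ?mem_undup ?map_f // big_seq1.
Qed.

(** * Maps additive on a subgroup; subgroups of free groups *)

Section AdditiveOn.
Variables (G V : zmodType) (H : zmodClosed G) (f : G -> V).
Hypothesis fB : {in H &, {morph f : x y / x - y}}.

Lemma on0 : f 0 = 0.
Proof. by have := fB (rpred0 H) (rpred0 H); rewrite !subrr. Qed.

Lemma onN : {in H, {morph f : x / - x}}.
Proof. by move=> x Hx; have := fB (rpred0 H) Hx; rewrite on0 !sub0r. Qed.

Lemma onD : {in H &, {morph f : x y / x + y}}.
Proof. by move=> x y Hx Hy; rewrite -{1}[y]opprK fB ?rpredN // onN // opprK. Qed.

Lemma onMn n : {in H, {morph f : x / x *+ n}}.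
Proof.
by move=> x Hx; elim: n => [|n IH]; rewrite ?mulr0n ?on0 // !mulrS onD ?rpredMn // IH.
Qed.

Lemma onMz z : {in H, {morph f : x / x *~ z}}.
Proof.
by move=> x Hx; case: z => n; rewrite /= ?onN ?rpredMn // onMn.
Qed.

Lemma on_sum (A : eqType) (s : seq A) (h : A -> G) : {in s, forall a, h a \in H} ->
  f (\sum_(a <- s) h a) = \sum_(a <- s) f (h a).
Proof.
elim: s => [|a s IH] hH; first by rewrite !big_nil on0.
have hs : {in s, forall a, h a \in H} by move=> b bs; apply: hH; rewrite inE bs orbT.
rewrite !big_cons onD ?IH // ?hH ?inE ?eqxx //.
by rewrite big_seq rpred_sum.
Qed.

End AdditiveOn.

Section SubgroupOfFree.
Variables (G : zmodType) (H : zmodClosed G) (T : choiceType) (f : G -> FA T).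
Hypothesis fB : {in H &, {morph f : x y / x - y}}.
Hypothesis f_inj : {in H, forall x, f x = 0 -> x = 0}.

(* The basis is read off leading terms: for a well-order of [T], pick for each
   [t] an element of [H] with leading position [t] and least positive leading
   coefficient. *)
Lemma free_subgroup_of_embedding : free_subgroup H.
Proof.
have [R [wfR trR totR]] := strict_wo_exists T.
have irrR := wf_irrefl wfR.
pose low t h := h \in H /\ forall s, f h s <> 0 -> s = t \/ R s t.
have lead h : h \in H -> h <> 0 -> exists2 t, low t h & f h t <> 0.
  move=> Hh nh; have /finite_seqP[s sE] := FA_fin (f h).
  have memS t : (t \in s) <-> f h t <> 0.
    by split=> [ts|ft]; [have : [set` s] t by []; rewrite -sE|
      have : [set t | f h t <> 0] t by []; rewrite sE].
  have [s0|[t /memS ts]] : s = [::] \/ exists t, f h t <> 0.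
    case: (s) memS => [|t ?] memS; [by left|right; exists t].
    by apply/memS; rewrite inE eqxx.
  - case: nh; apply: f_inj => //; apply: FAP => t; apply: contrapT => /memS.
    by rewrite s0.
  - have [//|u us umax] := seq_argmax trR _ ts (key := id).
    exists u; last exact/memS.
    by split=> // v /memS; exact: umax.
have lowB t h h' : low t h -> low t h' -> low t (h - h').
  move=> [Hh lh] [Hh' lh']; split; first exact: rpredB.
  move=> s; rewrite fB // FAB; case: (pselect (f h s = 0)) => [->|/lh//].
  by case: (pselect (f h' s = 0)) => [->|/lh'//]; rewrite subrr.
have lowMz t h z : low t h -> low t (h *~ z).
  move=> [Hh lh]; split; first exact: rpredMz.
  move=> s; rewrite (onMz fB) // FAMz; case: (pselect (f h s = 0)) => [->|/lh//].
  by rewrite mul0r.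
have low_lt t h : low t h -> f h t = 0 -> h = 0 \/ exists2 s, R s t & low s h.
  move=> [Hh lh] ft; have [->|/(lead _ Hh)[s sh fs]] := pselect (h = 0); first by left.
  right; exists s => //; have [E|//] := lh s fs.
  by case: fs; rewrite E.
pose good t h := [/\ low t h, 0 < f h t &
  forall h', low t h' -> exists q, f h' t = f h t * q].
have goodP t : (forall h, low t h -> f h t = 0) \/ exists h, good t h.
  have [[h [lh fh]]|no] := pselect (exists h, low t h /\ f h t <> 0); last first.
    by left=> h lh; apply: contrapT => fh; apply: no; exists h.
  (* The shift by one makes the least [d] yield the least positive leading coefficient. *)
  right; pose D d := `[< exists h, low t h /\ f h t = d.+1%:Z >].
  have exD : exists d, D d.
    have fh' : exists2 h, low t h & 0 < f h t.
      have [lt|gt|/esym//] := ltrgtP 0 (f h t); first by exists h.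
      exists (- h); last by rewrite (onN fB) ?lh.1 // -sub0r FAB FA0 sub0r oppr_gt0.
      by have := lowMz _ _ (-1) lh; rewrite mulrN1z.
    have [h' lh' fh0] := fh'; exists `|f h' t|.-1%N; apply/asboolP; exists h'.
    by split=> //; rewrite prednK ?absz_gt0 ?gt_eqF // gtz0_abs.
  have [d /asboolP[h0 [lh0 fh0]] dmin] := find_ex_minn exD.
  exists h0; split=> //; first by rewrite fh0.
  move=> h' lh'; exists (f h' t %/ f h0 t)%Z; rewrite mulrC.
  have E := divz_eq (f h' t) (f h0 t).
  have lr : low t (h' - h0 *~ (f h' t %/ f h0 t)%Z) by apply: lowB => //; exact: lowMz.
  have fr : f (h' - h0 *~ (f h' t %/ f h0 t)%Z) t = (f h' t %% f h0 t)%Z.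
    rewrite fB ?lh'.1 ?rpredMz ?lh0.1 // FAB (onMz fB) ?lh0.1 // FAMz {1}E.
    by rewrite mulrC addrAC subrr add0r.
  (* A nonzero remainder would be a smaller positive leading coefficient. *)
  rewrite {1}E -[RHS]addr0; congr (_ + _).
  case: (eqVneq (f h' t %% f h0 t)%Z 0) => // nz.
  have ge0 : 0 <= (f h' t %% f h0 t)%Z by apply: modz_ge0; rewrite fh0.
  have ltd : (f h' t %% f h0 t)%Z < d.+1%:Z by rewrite -fh0 ltz_pmod // fh0.
  have : D `|(f h' t %% f h0 t)%Z|.-1%N.
    apply/asboolP; eexists; split; first exact: lr.
    by rewrite fr prednK ?absz_gt0 // gez0_abs.
  move/dmin; move: ge0 nz ltd; case: (_ %% _)%Z => // -[|r] // _ _.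
  by rewrite /= ltz_nat ltnS => lt le; have := leq_ltn_trans le lt; rewrite ltnn.
have /choice[b bP] t : exists h, (forall h, low t h -> f h t = 0) \/ good t h.
  by have [?|[h ?]] := goodP t; [exists 0; left|exists h; right].
pose B := [set x | exists2 t, good t (b t) & x = b t].
exists B; split.
  move=> s c us sB sum0; apply: contrapT => nc.
  have {nc} [b0 b0s cb0] : exists2 b0, b0 \in s & c b0 <> 0.
    by apply: contrapT => no; apply: nc => x xs; apply: contrapT => cx; apply: no; exists x.
  have [t0 _ _] := sB _ b0s.
  have /choice[tau tauP] x : exists t, B x -> good t (b t) /\ x = b t.
    by have [[t gt xt]|nx] := pselect (B x); [exists t|exists t0].
  (* Among the elements with nonzero coefficient, the one with the largest leading position has a
     leading term that nothing cancels. *)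
  pose s' := [seq x <- s | c x != 0].
  have b0s' : b0 \in s' by rewrite mem_filter b0s andbT; apply/eqP.
  have [//|x xs' xmax] := seq_argmax trR _ b0s' (key := tau).
  move: xs'; rewrite mem_filter => /andP[/eqP cx xs].
  have [[[Hx lx] fx _] xE] := tauP x (sB _ xs).
  have sH y : y \in s -> y \in H.
    by move=> ys; have [[[+ _] _ _] yE] := tauP y (sB _ ys); rewrite -yE.
  have : f (\sum_(y <- s) y *~ c y) (tau x) = f x (tau x) * c x.
    rewrite (on_sum fB) => [|y ys]; last by rewrite rpredMz ?sH.
    rewrite FA_sum (bigD1_seq x) //= (onMz fB) ?sH // FAMz.
    rewrite big_seq_cond big1 ?addr0 // => y /andP[ys yx].
    rewrite (onMz fB) ?sH // FAMz; have [->|cy] := eqVneq (c y) 0; first by rewrite mulr0.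
    have [[[_ ly] _ _] yE] := tauP y (sB _ ys).
    have ys' : y \in s' by rewrite mem_filter cy.
    have ntau : tau x <> tau y.
      by move=> E; case/eqP: yx; rewrite xE yE E.
    suff -> : f y (tau x) = 0 by rewrite mul0r.
    rewrite -yE in ly; apply: contrapT => /ly[/ntau//|Rxy].
    by have [/esym//|Ryx] := xmax y ys'; exact: irrR (trR _ _ _ Rxy Ryx).
  rewrite sum0 (on0 fB) FA0 => /esym/eqP; rewrite mulf_eq0 => /orP[|/eqP//].
  by rewrite -xE in fx; rewrite gt_eqF.
have gen h : h \in H -> exists r : seq (G * int),
    (forall p, p \in r -> B p.1) /\ h = \sum_(p <- r) p.1 *~ p.2.
  move=> Hh; have [->|nh] := pselect (h = 0); first by exists [::]; rewrite big_nil.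
  (* Subtracting a multiple of [b t] removes the leading term, so induction on the leading position
     applies. *)
  have [t lt _] := lead h Hh nh; elim: (wfR t) h lt {Hh nh} => {}t _ IH h lh.
  have step h' : low t h' -> f h' t = 0 -> exists r : seq (G * int),
      (forall p, p \in r -> B p.1) /\ h' = \sum_(p <- r) p.1 *~ p.2.
    move=> lh' ft; have [->|[s Rst lsh]] := low_lt t h' lh' ft; last exact: IH Rst _ lsh.
    by exists [::]; rewrite big_nil.
  have [ft0|gt] := bP t; first exact: step (ft0 _ lh).
  have [lb _ /(_ _ lh)[q fq]] := gt.
  have [||r [rB rE]] := step (h - b t *~ q).
  - by apply: lowB => //; exact: lowMz.
  - by rewrite fB ?rpredMz ?lh.1 ?lb.1 // FAB (onMz fB) ?lb.1 // FAMz fq subrr.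
  exists ((b t, q) :: r); split=> [p|].
    by rewrite inE => /orP[/eqP->|]; [exists t|exact: rB].
  by rewrite big_cons -rE addrC subrK.
apply/seteqP; split=> h /=; last by case/gen=> r [rB ->]; exact: Zspan_pairs.
case=> s [c [sB ->]]; rewrite big_seq rpred_sum // => x /sB[t [[Hb _] _ _] ->].
by rewrite rpredMz.
Qed.

End SubgroupOfFree.

(** * Existence of the cardinals aleph_n *)

Lemma card_lt_congr T U V (A : set T) (B : set U) (C : set V) :
  B #= A -> card_lt A C -> card_lt B C.
Proof. by move=> BA /andP[leAC nCA]; rewrite /card_lt (card_le_eql BA) leAC (card_le_eqr BA). Qed.

(** By recursion along [R], each [a] in [A] is sent to an element of [B] not yet used. Either this
    always succeeds and [A] injects into [B], or at some [a] the set [B] is exhausted by the images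
    of earlier elements. *)
Lemma wo_segment_compare T U (A : set T) (B : set U) (R : T -> T -> Prop) :
  well_founded R -> (forall x y, x = y \/ R x y \/ R y x) ->
  A #<= B \/ exists2 a, A a & B #<= A `&` [set x | R x a].
Proof.
move=> wfR totR; have [->|/set0P[b0 Bb0]] := eqVneq B set0.
  have [->|/set0P[a Aa]] := eqVneq A set0; first by left.
  by right; exists a.
have [f fE] := wf_rec (fun a (rec : forall a', R a' a -> U) =>
  if pselect (exists b, B b /\ forall a' (p : R a' a), A a' -> rec a' p <> b) is left p
  then projT1 (cid p) else b0) wfR.
have [full|nfull] := pselect (forall a, A a ->
    exists b, B b /\ forall a', R a' a -> A a' -> f a' <> b); [left|right].
  have fP a : A a -> B (f a) /\ forall a', R a' a -> A a' -> f a' <> f a.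
    by move=> Aa; rewrite fE; case: pselect => [p|/(_ (full a Aa))//]; case: cid.
  apply: (card_le_inj (f := f)) => [a /fP[]//|x y Ax Ay E].
  have [//|[xy|yx]] := totR x y; first by case: (fP y Ay) => _ /(_ x xy Ax).
  by case: (fP x Ax) => _ /(_ y yx Ay)/(_ (esym E)).
have [a [Aa na]] : exists a, A a /\
    ~ exists b, B b /\ forall a', R a' a -> A a' -> f a' <> b.
  by apply: contrapT => no; apply: nfull => a Aa; apply: contrapT => na; apply: no; exists a.
exists a => //; apply: (card_le_surj (f := f)) => b Bb.
apply: contrapT => nb; apply: na; exists b; split=> // a' Ra Aa' E.
by apply: nb; exists a'.
Qed.

Lemma Cantor_card S : ~ ([set: set S] #<= [set: S]).
Proof.
case: (pselect (inhabited S)) => [iS /(card_leT_injP _ iS)[f finj]|nS].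
  pose D := [set x | exists A : set S, f A = x /\ ~ A x].
  have [DD|nD] := pselect (D (f D)).
    by have [A [/finj-> nA]] := DD.
  by apply: (nD); exists D.
have -> : [set: S] = set0 by apply/seteqP; split=> x _ //; case: nS.
by move/card_le0P => /seteqP[/(_ set0 I)].
Qed.

(** In a well-order of the power set of [S], the shortest initial segment that does not inject into
    [S], or else the whole power set, has the successor cardinality. *)
Lemma succ_card_exists S : exists T, is_succ_card S T.
Proof.
have [R [wfR _ totR]] := strict_wo_exists (set S).
have [A [nAS segA]] : exists A : set (set S), ~ (A #<= [set: S]) /\
    forall a, A a -> A `&` [set x | R x a] #<= [set: S].
  have [[x0 bad0]|ok] := pselect (exists x, ~ ([set y | R y x] #<= [set: S])); last first.
    exists setT; split; first exact: Cantor_card.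
    by move=> a _; rewrite setTI; apply: contrapT => bad; apply: ok; exists a.
  have [x [bad xmin]] : exists x, ~ ([set y | R y x] #<= [set: S]) /\
      forall y, R y x -> [set z | R z y] #<= [set: S].
    elim: (wfR x0) bad0 => x _ IH bad.
    have [[y [Ryx bady]]|ny] :=
      pselect (exists y, R y x /\ ~ ([set z | R z y] #<= [set: S])).
      exact: IH bady.
    by exists x; split=> // y Ryx; apply: contrapT => bady; apply: ny; exists y.
  exists [set y | R y x]; split=> // y Ryx; apply: card_le_trans (xmin y Ryx).
  by apply: subset_card_le => z [].
exists A; have AT := card_setT A; split.
  rewrite /card_lt (card_le_eqr AT) (card_le_eql AT); apply/andP; split; last exact/negP.
  have [//|[a Aa Sa]] := wo_segment_compare A [set: S] wfR totR.
  by apply: card_le_trans Sa _; apply: subset_card_le => z [].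
move=> X /andP[_]; rewrite (card_le_eql AT) => /negP nAX.
have [//|[a Aa Xa]] := wo_segment_compare A X wfR totR.
exact: card_le_trans Xa (segA a Aa).
Qed.

Lemma aleph_exists n : exists K, is_aleph n K.
Proof.
elim: n => [|n [S alS]]; first by exists nat; exact: card_eqxx.
by have [T ST] := succ_card_exists S; exists T, S.
Qed.

Lemma card_lt_succ T S K (A : set T) :
  is_succ_card S K -> card_lt A [set: K] -> A #<= [set: S].
Proof.
move=> [_ succ] AK; have /andP[/card_subP[C CA _] _] := AK.
by rewrite -(card_le_eql CA); apply: succ; exact: card_lt_congr AK.
Qed.

(** * Embedding small subgroups into free groups *)

Section SmallSubgroups.
Variables (j : nat) (L : choiceType) (x0 : L).
Local Notation k := j.+1.
Local Notation Lam := ('I_k -> nat -> L).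
Variable m : Lam -> nat -> nat.
Local Notation F := (mod_rel x0 m).
Local Notation relK := (relK x0 m).

Let rep (h : F) : FA (gens k L) := repr h.

Let rep_eq (h : F) x : x - rep h \in relK -> \pi_F%qT x = h.
Proof. by rewrite Quotient.idealrBE => /eqP; rewrite reprK. Qed.

Let repB (g h : F) : rep (g - h) - (rep g - rep h) \in relK.
Proof. by rewrite Quotient.idealrBE raddfB /= !reprK. Qed.

(** [X] collects the coordinates of the tuples whose [y] generators occur in representatives of
    elements of [H], finitely many for each element. The embedding is [phi] applied to
    representatives; it is injective because [phi] preserves classes. *)
Lemma small_embedding (H : zmodClosed F) : small j [set x | x \in H] ->
  exists f : F -> FA (gens k L), {in H &, {morph f : x y / x - y}} /\
    {in H, forall x, f x = 0 -> x = 0}.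
Proof.
move=> smallH.
pose C (h : F) := [set x | exists eta n i, rep h (ygen eta n) <> 0 /\ x = eta i].
pose X := [set x | exists2 h, h \in H & C h x].
have /choice[c cinj] h : exists c : (nat -> L) -> nat, {in C h &, injective c}.
  apply/countable_injP; apply: finite_set_countable.
  pose coord (p : gens k L * 'I_k) := match p.1 with
    | inl (_, _, eta) => eta p.2 | inr (eta, _) => eta p.2 end.
  apply: sub_finite_set (finite_image coord
    (finite_setX (FA_fin (rep h)) (finite_finset (X := [set: 'I_k])))).
  by move=> x [eta [n [i [nz ->]]]]; exists (ygen eta n, i).
have smallX : small j X.
  have /choice[o oP] x : exists h, X x -> h \in H /\ C h x.
    by have [[h Hh Chx]|nX] := pselect (X x); [exists h|exists 0].
  apply: small_le (small_setX_nat smallH).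
  apply: (card_le_inj (f := fun x => (o x, c (o x) x))) => [x /oP[]//|x y Xx Xy [E]].
  have [_ Cx] := oP x Xx; have [_ Cy] := oP y Xy.
  by rewrite -E in Cy *; apply: cinj; exact/mem_set.
(* All [j.+1] positions are allowed, just enough for a set of cardinality at most aleph_j. *)
have [l [n0 [_ wf]]] := dep_wf (u := fun=> [set: 'I_k]%SET) smallX
  (fun=> eq_leq (esym (etrans (cardsT _) (card_ord _)))).
have [phi [phiK phi0]] := reduction_exists x0 m wf.
have repX h eta n : h \in H -> rep h (ygen eta n) <> 0 -> coords_in X eta.
  by move=> Hh nz i; exists h => //; exists eta, n, i.
exists (phi \o rep); split=> [g h Hg Hh|h Hh /= ph]; last first.
  rewrite -(reprK h) -[RHS](reprK (0 : F)); apply/eqP; rewrite -Quotient.idealrBE.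
  have -> : repr h - repr (0 : F) = - (phi (rep h) - rep h) - (repr (0 : F) - 0).
    by rewrite ph sub0r opprK subr0.
  by rewrite rpredB ?rpredN ?phiK // Quotient.idealrBE reprK raddf0.
(* The failure of [rep] to be additive is a combination of relators, by [rels_supp] only at tuples
   over [X], where [phi] kills them. *)
apply/eqP; rewrite -subr_eq0 /= -!(raddfB phi); apply/eqP.
have /asboolP[z zE] := repB g h; rewrite -zE raddf_lift.
rewrite (@lift_eq _ _ _ (fun=> 0)) => [|[eta n] zn0 /=].
  by rewrite /lift fsbig1 // => t _; rewrite mul0rz.
apply: phi0; apply: contrapT => nX; apply: zn0; move: n.
apply: (rels_supp (x0 := x0) (m := m)) => n; rewrite zE !FAB.
have rep0 h' : h' \in H -> rep h' (ygen eta n) = 0.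
  by move=> Hh'; apply: contrapT => /(repX _ _ _ Hh').
by rewrite !rep0 ?rpredB // !subrr.
Qed.

(** The cyclic subgroup generated by [x] is countable, hence embeds in a free group. *)
Lemma mod_rel_torsion_free : torsion_free F.
Proof.
move=> x n n0 xn.
pose H : {pred F} := fun y => `[< exists z, y = x *~ z >].
have H_closed : zmod_closed H.
  split=> [|_ _ /asboolP[a ->] /asboolP[b ->]]; apply/asboolP.
    by exists 0; rewrite mulr0z.
  by exists (a - b); rewrite mulrzBr.
pose Hz : zmodClosed F := HB.pack H (GRing.isZmodClosed.Build _ H H_closed).
have cH : countable [set y | y \in Hz].
  apply: sub_countable (countableP [set: int]).
  by apply: (card_le_surj (f := fun z => x *~ z)) => y /asboolP[z ->]; exists z.
have [f [fB f0]] := small_embedding (countable_small j cH).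
have Hx : x \in Hz by apply/asboolP; exists 1; rewrite mulr1z.
apply: f0 => //; apply: FAP => t; have := congr1 (fun u : FA _ => u t) (onMz fB n%:Z Hx).
rewrite -pmulrn xn (on0 fB) FAMz FA0 => /esym/eqP.
by rewrite mulf_eq0 (gt_eqF (n0 : 0 < n%:Z)) orbF => /eqP.
Qed.

Lemma mod_rel_aleph_free : aleph_free k F.
Proof.
have [K [S [alS SK]]] := aleph_exists k; exists K; split; first by exists S.
move=> H HK; have HS := card_lt_succ SK HK.
have [f [fB f0]] := small_embedding (small_le HS (is_aleph_small alS)).
exact: free_subgroup_of_embedding fB f0.
Qed.

End SmallSubgroups.

(** * Cotorsion groups and prediction *)

(** This amounts to [Ext(A, C) = 0] for all [A] generated by elements [x_n] with defining relations
    [x_n = (m_n + 1) x_(n+1)], that is, for torsion-free [A] of rank one. *)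
Definition divisor_solvable (C : zmodType) : Prop :=
  forall (m : nat -> nat) (c : nat -> C),
    exists x : nat -> C, forall n, x n = x n.+1 *+ (m n).+1 + c n.

(** One step of division with remainder between relations of the form [e *+ N = x *~ a]. *)
Lemma mulrz_sub_mod (G : zmodType) (e f x : G) (N : nat) (a g q : int) :
  (e - f *~ q) *+ N - x *~ (a - g * q) = (e *+ N - x *~ a) - (f *+ N - x *~ g) *~ q.
Proof.
rewrite mulrnBl mulrzBr mulrzA mulrzBl !pmulrn !opprD addrACA.
by rewrite -!mulrzA [q * N%:Z]mulrC.
Qed.

(** * Splitting extensions by partial retractions *)

Section PartialRetractions.
Variables (A C : zmodType) (E : extension A C).
Local Notation G := (ext_mid E).
Local Notation inC := (ext_in E).
Local Notation outA := (ext_out E).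
Hypotheses (A_tf : torsion_free A) (C_solv : divisor_solvable C).

Definition dom (gr : set (G * C)) : set G := [set e | exists c, gr (e, c)].

(* Graphs of retractions onto [C] of subgroups [H] such that [G / H] is
   torsion-free. *)
Definition retraction_graph (gr : set (G * C)) : Prop :=
  [/\ forall c, gr (inC c, c), forall p q, gr p -> gr q -> gr (p - q),
      forall c, gr (0, c) -> c = 0 &
      forall e n, (0 < n)%N -> dom gr (e *+ n) -> dom gr e].

Lemma retraction_graph_in : retraction_graph [set p | p.1 = inC p.2].
Proof.
split=> [//|[e c] [e' c'] /= -> ->|c /=|e n n0 [c /= ec]]; first by rewrite raddfB.
  by move/esym; rewrite -(raddf0 inC) => /(@ext_in_inj _ _ E).
have oe : outA e = 0.
  by apply: (A_tf n0); rewrite -raddfMn; apply/(@ext_exact _ _ E); exists c.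
by have [c' ce] := (@ext_exact _ _ E e).1 oe; exists c'.
Qed.

(** Modulo [D], the pure closure of [x] has rank one and is the union of the cyclic groups of
    elements [xs n]. Solving a system in [C] gives compatible values at the [xs n]. *)
Lemma retraction_graph_extend (gr : set (G * C)) x : retraction_graph gr ->
  ~ dom gr x -> exists2 gr', retraction_graph gr' & gr `<` gr'.
Proof.
move=> [gr_in grB gr0 gr_pure] nDx.
have gr_closed : zmod_closed (fun p => `[< gr p >]).
  split=> [|p q /asboolP Gp /asboolP Gq]; apply/asboolP; last exact: grB.
  by have := gr_in 0; rewrite raddf0.
pose Gz : zmodClosed (G * C)%type := HB.pack (fun p => `[< gr p >] : bool)
  (GRing.isZmodClosed.Build _ (fun p => `[< gr p >]) gr_closed).
have GzP p : p \in Gz <-> gr p by split=> /asboolP.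
have D_closed : zmod_closed (fun e => `[< dom gr e >]).
  split=> [|e e' /asboolP[c Gc] /asboolP[c' Gc']]; apply/asboolP.
    by exists 0; exact/GzP/(rpred0 Gz).
  by exists (c - c'); have := grB _ _ Gc Gc'.
pose D : zmodClosed G := HB.pack (fun e => `[< dom gr e >] : bool)
  (GRing.isZmodClosed.Build _ (fun e => `[< dom gr e >]) D_closed).
have DP e : e \in D <-> dom gr e by split=> /asboolP.
have D_pure e n : (0 < n)%N -> e *+ n \in D -> e \in D.
  by move=> n0 /DP De; apply/DP; exact: gr_pure De.
have D_purez e (z : int) : z != 0 -> e *~ z \in D -> e \in D.
  case: z => n nz; first by apply: D_pure; rewrite lt0n.
  by rewrite -(rpredN D) -mulrNz; apply: D_pure.
have nx z : x *~ z \in D -> z = 0.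
  by move=> Dz; apply: contrapT => /eqP /D_purez/(_ Dz)/DP.
(* Modulo [D], [xn] is [(g / n!) x] and generates the group of all existing elements
   [(a / n!) x]. *)
have gP n : exists g xn, [/\ (0 < g)%N, xn *+ n`! - x *+ g \in D &
    forall a e, e *+ n`! - x *~ a \in D -> exists t, a = g%:Z * t].
  pose Q g := `[< exists xn, xn *+ n`! - x *+ g.+1 \in D >].
  have exQ : exists g, Q g.
    by exists n`!.-1; apply/asboolP; exists x; rewrite prednK ?fact_gt0 // subrr rpred0.
  have [g /asboolP[xn Hxn] gmin] := find_ex_minn exQ.
  exists g.+1, xn; split=> // a e He; exists (a %/ g.+1%:Z)%Z; rewrite mulrC.
  rewrite {1}(divz_eq a g.+1%:Z) -[RHS]addr0; congr (_ + _).
  have ge0 : 0 <= (a %% g.+1%:Z)%Z by exact: modz_ge0.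
  have ltg : (a %% g.+1%:Z)%Z < g.+1%:Z by exact: ltz_pmod.
  have Hr : (e - xn *~ (a %/ g.+1%:Z)%Z) *+ n`! - x *~ (a %% g.+1%:Z)%Z \in D.
    have -> : (a %% g.+1%:Z)%Z = a - g.+1%:Z * (a %/ g.+1%:Z)%Z.
      by rewrite {2}(divz_eq a g.+1%:Z); ring.
    by rewrite mulrz_sub_mod rpredB ?rpredMz // -pmulrn.
  case: (a %% _)%Z ge0 ltg Hr => // -[//|r] _; rewrite ltz_nat ltnS => ltr Hr.
  have : Q r by apply/asboolP; eexists; exact: Hr.
  by move=> /gmin le; have := leq_ltn_trans le ltr; rewrite ltnn.
have /choice[g {}gP] := gP; have /choice[xs {}gP] := gP.
have xsS n : exists q, xs n - xs n.+1 *+ q.+1 \in D.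
  have [g0 gD _] := gP n; have [g0' gD' gdiv'] := gP n.+1.
  have gDS : xs n *+ n.+1`! - x *~ (g n * n.+1)%:Z \in D.
    by have := rpredMn n.+1 gD; rewrite mulrnBl -!mulrnA [(n`! * _)%N]mulnC -factS -pmulrn.
  have [t tE] := gdiv' _ _ gDS.
  have t0 : 0 < t.
    by rewrite -(pmulr_rgt0 _ (g0' : 0 < (g n.+1)%:Z)) -tE ltz_nat muln_gt0 g0.
  case: t tE t0 => // -[//|q] tE _; exists q.
  apply: (D_pure _ n.+1`!); first exact: fact_gt0.
  rewrite -[X in X \in _]subr0 -(mulr0z x) -(subrr (g n * n.+1)%:Z) {2}tE
    [xs n.+1 *+ _]pmulrn.
  by rewrite mulrz_sub_mod rpredB ?rpredMz // -pmulrn.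
have /choice[m xsD] := xsS.
(* [d n] is the value already imposed on [xs n - xs n.+1 *+ (m n).+1], hence the constant in the
   system for the values [y n]. *)
have /choice[d dP] n : exists c, gr (xs n - xs n.+1 *+ (m n).+1, c) by exact/DP.
have [y yE] := C_solv m d.
pose w n : G * C := (xs n, y n).
have w1 n a e c : ((e, c) - w n *~ a).1 = e - xs n *~ a.
  by rewrite (raddfB fst) (raddfMz fst).
have w2 n a e c : ((e, c) - w n *~ a).2 = c - y n *~ a.
  by rewrite (raddfB snd) (raddfMz snd).
have wE n a e c : (e, c) - w n *~ a = (e - xs n *~ a, c - y n *~ a).
  by rewrite [LHS]surjective_pairing w1 w2.
have wS n : w n - w n.+1 *~ (m n).+1 \in Gz.
  by rewrite wE; apply/GzP; have := dP n; rewrite yE -pmulrn addrAC subrr add0r.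
pose gr' := [set p | exists n a, p - w n *~ a \in Gz].
(* Two elements of [gr'] can be compared once both are written at a common level. *)
have up n k p a : p - w n *~ a \in Gz -> exists b, p - w (k + n)%N *~ b \in Gz.
  elim: k a n p => [|k IH] a n p Gp; first by exists a.
  have [b Hb] := IH a n p Gp; exists ((m (k + n)%N).+1%:Z * b).
  have := rpredD Hb (rpredMz b (wS (k + n)%N)).
  by rewrite mulrzBl -mulrzA addrA subrK.
have gr'B p q : gr' p -> gr' q -> gr' (p - q).
  move=> [n [a Ha]] [n' [b Hb]].
  have [a' Ha'] := up n n' _ _ Ha; have [b' Hb'] := up n' n _ _ Hb.
  rewrite addnC in Ha'; exists (n + n')%N, (a' - b').
  by have := rpredB Ha' Hb'; rewrite mulrzBr !opprD addrACA.
have gr_sub p : gr p -> gr' p by move=> Gp; exists 0%N, 0; rewrite mulr0z subr0; exact/GzP.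
have gr'_dom e : dom gr' e <-> exists n a, e - xs n *~ a \in D.
  split=> [[c [n [a]]]|[n [a /DP[c Gc]]]].
    by rewrite wE => /GzP Gc; exists n, a; apply/DP; eexists; exact: Gc.
  by exists (c + y n *~ a), n, a; rewrite wE addrK; exact/GzP.
have gr'_pure e N : (0 < N)%N -> dom gr' (e *+ N) -> dom gr' e.
  move=> N0 /gr'_dom[n [a Ha]]; have [g0 gD _] := gP n.
  have {}Ha : e *+ (N * n`!) - x *~ ((g n)%:Z * a) \in D.
    have := rpredD (rpredMn n`! Ha) (rpredMz a gD).
    rewrite mulrnBl mulrzBl -mulrnA !pmulrn -!mulrzA [a * _]mulrC.
    by rewrite addrA subrK.
  (* As [M] divides [M!], the element [e] is modulo [D] of the form [(a / M!) x], hence a multiple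
     of [xs M]. *)
  pose M := (N * n`!)%N; have M0 : (0 < M)%N by rewrite muln_gt0 N0 fact_gt0.
  have /dvdnP[r rE] : (M %| M`!)%N by rewrite dvdn_fact // M0 leqnn.
  have [_ gDM gdiv] := gP M.
  have HM : e *+ M`! - x *~ ((g n)%:Z * a * r%:Z) \in D.
    by have := rpredMn r Ha; rewrite mulrnBl -mulrnA [(N * _ * _)%N]mulnC -rE !pmulrn -!mulrzA.
  have [t tE] := gdiv _ _ HM; apply/gr'_dom; exists M, t.
  apply: (D_pure _ M`!); first exact: fact_gt0.
  rewrite -[X in X \in _]subr0 -(mulr0z x) -(subrr ((g n)%:Z * a * r%:Z)) {2}tE.
  by rewrite mulrz_sub_mod rpredB ?rpredMz // -pmulrn.
exists gr'; first split=> //.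
- by move=> c; apply: gr_sub; exact: gr_in.
- move=> c [n [a /GzP Ha]].
  have a0 : a = 0.
    have xa : xs n *~ a \in D.
      by rewrite -(rpredN D) -sub0r; apply/DP; rewrite wE in Ha; eexists; exact: Ha.
    have [g0 gD _] := gP n; have := rpredB (rpredMn n`! xa) (rpredMz a gD).
    rewrite mulrzBl opprB !pmulrn -!mulrzA [a * _]mulrC addrC subrK => /nx/eqP.
    by rewrite mulf_eq0 (gt_eqF (g0 : 0 < (g n)%:Z)) => /eqP.
  by move: Ha; rewrite a0 mulr0z subr0; exact: gr0.
- split=> // sub; apply: nDx.
  have [||c Gc] := gr'_pure x (g 0%N); first by have [] := gP 0%N.
    apply/gr'_dom; exists 0%N, 1; rewrite mulr1z -(rpredN D) opprB.
    by have [] := gP 0%N.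
  by exists c; exact: sub.
Qed.

Lemma retraction_exists : exists gr, retraction_graph gr /\ forall e, dom gr e.
Proof.
pose P gr := gr = set0 \/ retraction_graph gr.
have [F FP totF|gr [Pgr grmax]] := @Zorn_bigcup _ P.
  have [[A0 FA0 gA0]|no] := pselect (exists2 A0, F A0 & retraction_graph A0); last first.
    left; apply/seteqP; split=> // p [B FB Bp]; have [B0|gB] := FP _ FB.
      by rewrite B0 in Bp.
    by case: no; exists B.
  have good B p : F B -> B p -> retraction_graph B.
    by move=> FB Bp; have [B0|//] := FP _ FB; rewrite B0 in Bp.
  right; split=> [c|p q [B FB Bp] [B' FB' Bq]|c [B FB Bc]|e n n0 [c [B FB Bc]]].
  - by exists A0 => //; case: gA0.
  - have [BB'|B'B] := totF _ _ FB FB'.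
      by exists B' => //; case: (good _ _ FB' Bq) => _ + _ _; apply=> //; exact: BB'.
    by exists B => //; case: (good _ _ FB Bp) => _ + _ _; apply=> //; exact: B'B.
  - by case: (good _ _ FB Bc) => _ _ + _; apply.
  - have [_ _ _ pure] := good _ _ FB Bc.
    by have [|c' Bc'] := pure e n n0; [exists c|exists c', B].
have gr_good : retraction_graph gr.
  case: Pgr => // gr0; case: (grmax [set p | p.1 = inC p.2]); last first.
    by right; exact: retraction_graph_in.
  by rewrite gr0; split=> // /(_ (inC 0, 0)); apply.
exists gr; split=> // e; apply: contrapT => /(retraction_graph_extend gr_good)[gr' good' lt].
by apply: grmax lt _; right.
Qed.

Lemma ext_split : ext_equiv E (split_extension A C).
Proof.
have [gr [[gr_in grB gr0 _] /choice[r rP]]] := retraction_exists.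
have r_eq e c : gr (e, c) -> r e = c.
  move=> Gc; apply/eqP; rewrite -subr_eq0; apply/eqP; apply: gr0.
  by have := grB _ _ (rP e) Gc; rewrite -[(e, _) - _]/(e - e, r e - c) subrr.
have phi_zmod : zmod_morphism (fun e => (r e, outA e) : C * A).
  move=> e e'; rewrite raddfB; congr (_, _); apply: r_eq.
  exact: grB (rP e) (rP e').
pose phi : {additive G -> (C * A)%type} := HB.pack (fun e => (r e, outA e) : C * A)
  (GRing.isZmodMorphism.Build _ _ _ phi_zmod).
exists phi; split=> [c|//]; congr (_, _); first exact/r_eq/gr_in.
by apply/(@ext_exact _ _ E); exists c.
Qed.

End PartialRetractions.

Lemma cotorsion_of_divisor_solvable C : divisor_solvable C -> cotorsion C.
Proof. by move=> C_solv A A_tf E; exact: ext_split. Qed.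

(** * Predicting values along a tuple *)

Section Prediction.
Variables (j : nat) (L : choiceType) (x0 : L) (C : zmodType).
Local Notation k := j.+1.
Local Notation Lam := ('I_k -> nat -> L).
Variables (Ls : 'I_k -> set L) (decN : L -> nat) (guess : 'I_k -> L -> Lam -> C).
Implicit Types (eta theta : Lam) (i : 'I_k).

Definition below i theta := forall i', (i' < i)%N -> forall t, Ls i' (theta i' t).

(* Entries of the [i]-th coordinate code functions of the coordinates before
   [i]; those of coordinate [0] moreover carry a natural number. *)
Definition codes i := forall (a : nat) (f : Lam -> C),
  (forall theta theta', (forall i', (i' < i)%N -> theta i' = theta' i') ->
    f theta = f theta') ->
  exists l, [/\ Ls i l, i = ord0 -> decN l = a &
    forall theta, below i theta -> guess i l theta = f theta].

Hypothesis all_codes : forall i, codes i.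
Variables (g : 'I_k -> nat -> Lam -> C) (a : nat -> nat).

Let mix i eta theta s : Lam :=
  fun i' => if (i' < i)%N then theta i' else if i' == i then s else eta i'.

(** The truncation at [(i, n)] retains only the entries [x t] with [t < n], so [x n] can be chosen
    by recursion to code the target as a function of the coordinates before [i], those after [i]
    being fixed by [eta]. *)
Lemma predict_coord i eta : exists x : nat -> L, [/\ forall n, Ls i (x n),
  i = ord0 -> forall n, decN (x n) = a n &
  forall n theta, below i theta -> theta i = x ->
    (forall i', (i < i')%N -> theta i' = eta i') ->
    guess i (x n) theta = g i n (trunc x0 i n theta)].
Proof.
have /choice[code codeP] (p : nat * (nat -> L)) : exists l,
    [/\ Ls i l, i = ord0 -> decN l = a p.1 &
    forall theta, below i theta -> guess i l theta = g i p.1 (mix i eta theta p.2)].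
  apply: all_codes => theta theta' E; congr (g i p.1 _); apply/funext => i'.
  by rewrite /mix; case: ifP => // /E.
(* [s n] is [x] below [n] padded with [x0], exactly what [trunc] leaves of coordinate [i]. *)
pose s := fix s n : nat -> L := if n is n'.+1 then
  fun t => if t == n' then code (n', s n') else s n' t else fun=> x0.
pose x t := code (t, s t).
have sE n t : s n t = if (n <= t)%N then x0 else x t.
  elim: n => [//|n IH] /=; have [->|tn] := eqVneq t n; first by rewrite ltnn.
  by rewrite IH [in RHS]ltn_neqAle [n == t]eq_sym tn.
exists x; split=> [n|i0 n|n theta th thi thgt].
- by case: (codeP (n, s n)).
- by case: (codeP (n, s n)) => _ /(_ i0).
have [_ _ /(_ _ th) ->] := codeP (n, s n); congr (g i n _).
apply/funext => i'; apply/funext => t; rewrite /mix /trunc /=.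
have [->|ii'] := eqVneq i' i; first by rewrite ltnn /= sE thi.
by case: ltnP => //= le; rewrite thgt // ltn_neqAle eq_sym ii' le.
Qed.

Lemma prediction : exists eta, (forall n, decN (eta ord0 n) = a n) /\
  forall i n, guess i (eta i n) eta = g i n (trunc x0 i n eta).
Proof.
(* [d] counts the coordinates already chosen, starting from the last one. *)
have H d : exists eta, forall i, (k <= i + d)%N -> [/\ forall n, Ls i (eta i n),
    i = ord0 -> forall n, decN (eta i n) = a n &
    forall n theta, below i theta ->
      (forall i', (i <= i')%N -> theta i' = eta i') ->
      guess i (eta i n) theta = g i n (trunc x0 i n theta)].
  elim: d => [|d [eta IH]].
    by exists (fun _ _ => x0) => i; rewrite addn0 leqNgt ltn_ord.
  have [kd|dk] := leqP k d.
    exists eta => i _; apply: IH; exact: leq_trans kd (leq_addl _ _).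
  have lt : (k - d.+1 < k)%N by rewrite ltn_subrL.
  pose i1 := Ordinal lt; have [x [xL xN xP]] := predict_coord i1 eta.
  exists (fun i => if i == i1 then x else eta i) => i ki.
  have [-> |ii1] := eqVneq i i1.
    split=> // n theta th thge; apply: xP => // [|i' lt']; first by rewrite thge ?eqxx.
    by rewrite thge ?(ltnW lt') // ifN //; apply: contraTneq lt' => ->; rewrite ltnn.
  have i1i : (i1 < i)%N.
    by rewrite ltn_neqAle eq_sym ii1 /= leq_subLR addnC.
  have [|iL iN iP] := IH i.
    by move: i1i; rewrite /= ltn_subLR // addSn ltnS addnC.
  split=> // n theta th thge; apply: iP => // i' ii'.
  rewrite thge // ifN //; apply: contraTneq (leq_trans i1i ii') => ->.
  by rewrite ltnn.
have [eta etaP] := H k; exists eta; have {}etaP i := etaP i (leq_addl _ _).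
split=> [n|i n]; first by case: (etaP ord0) => _ /(_ erefl).
by have [_ _ iP] := etaP i; apply: iP => // i' _; have [] := etaP i'.
Qed.

End Prediction.

(** Vanishing of Ext extends the map sending relators to [target] to some [Psi]. At a tuple that
    predicts [Psi] on its [e] generators, these cancel the guesses, and the values of [Psi] at the
    [y] generators solve the system. *)
Lemma Ext_eq0_divisor_solvable j (L : choiceType) (x0 : L) (C : zmodType)
    (Ls : 'I_j.+1 -> set L) (decN : L -> nat) guess :
  (forall i, codes (C := C) Ls decN guess i) ->
  Ext_eq0 (mod_rel x0 (fun eta : 'I_j.+1 -> nat -> L => fun n => decN (eta ord0 n))) C ->
  divisor_solvable C.
Proof.
move=> all_codes; set m := (fun eta n => _) => ext0 a c.
pose target (z : ('I_j.+1 -> nat -> L) * nat) : C :=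
  c z.2 - \sum_(i < j.+1) guess i (z.1 i z.2) z.1.
have /choice[inv invK] x : exists z, x \in relK x0 m -> lift (relator x0 m) z = x.
  by have [/asboolP[z zx]|nx] := boolP (x \in relK x0 m); [exists z|exists 0].
have [|Psi PsiK] := @Ext_quot_extend _ C (relK x0 m) (fun x => lift target (inv x)) _ ext0.
  move=> x y Kx Ky; rewrite -raddfB; congr (lift _ _).
  by apply: (rels_inj (x0 := x0) (m := m)); rewrite raddfB /= !invK ?rpredB.
have [eta [eta0 etaP]] := prediction x0 all_codes (fun i n theta => Psi (egens i n theta)) a.
exists (fun n => Psi (ygens eta n)) => n.
have : Psi (relator x0 m (eta, n)) = target (eta, n).
  rewrite PsiK ?relator_relK //; have -> : inv (relator x0 m (eta, n)) = dirac (eta, n).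
    by apply: (rels_inj (x0 := x0) (m := m)); rewrite lift_dirac invK ?relator_relK.
  by rewrite lift_dirac.
rewrite /relator /target !(raddfB Psi) (raddfMz Psi) (raddf_sum Psi) /= /m eta0 -pmulrn.
rewrite (eq_bigr _ (fun i _ => etaP i n)) => /addIr <-.
by rewrite addrC subrK.
Qed.

(** * Infinite cardinals equal to their countable power *)

Definition inj_le (T U : Type) : Prop := exists f : T -> U, injective f.

Lemma inj_le_refl T : inj_le T T. Proof. by exists id. Qed.

Lemma inj_le_trans T U V : inj_le T U -> inj_le U V -> inj_le T V.
Proof. by move=> [f fI] [g gI]; exists (g \o f); exact: inj_comp. Qed.

Lemma inj_le_prod T T' U U' : inj_le T T' -> inj_le U U' -> inj_le (T * U) (T' * U').
Proof. by move=> [f fI] [g gI]; exists (fun p => (f p.1, g p.2)) => -[a b] [c d] [/fI -> /gI ->]. Qed.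

Lemma inj_le_fun A T U : inj_le T U -> inj_le (A -> T) (A -> U).
Proof.
move=> [f fI]; exists (fun h => f \o h) => h h' E; apply/funext => a.
exact/fI/(congr1 (fun u => u a) E).
Qed.

Lemma inj_le_set T U : inj_le T U -> inj_le (set T) (set U).
Proof.
move=> [f fI]; exists (fun X => f @` X) => X Y E.
have imE (Z : set T) x : (f @` Z) (f x) -> Z x by case=> y Zy /fI <-.
by apply/seteqP; split=> x Zx; apply: imE; [rewrite -E|rewrite E]; exists x.
Qed.

Lemma inj_le_graph A T : inj_le (A -> T) (set (A * T)).
Proof.
exists (fun h => [set p | h p.1 = p.2]) => h h' E; apply/funext => a.
by have : [set p | h p.1 = p.2] (a, h a) by []; rewrite E => /= ->.
Qed.

Lemma inj_le_uncurry A T : inj_le (A -> set T) (set (A * T)).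
Proof.
exists (fun h => [set p | h p.1 p.2]) => h h' E; apply/funext => a.
by apply/funext => t; exact: (congr1 (fun u => u (a, t)) E).
Qed.

Definition omega_closed (U : Type) : Prop := inj_le nat U /\ inj_le (nat -> U) U.

Section OmegaClosed.
Variable U : Type.
Hypothesis U_closed : omega_closed U.

Lemma omega_inhabited : inhabited U.
Proof. by case: U_closed => -[f _] _; exists; exact: f 0%N. Qed.

Lemma omega_prod T V : inj_le T U -> inj_le V U -> inj_le (T * V) U.
Proof.
move=> TU VU; apply: inj_le_trans (inj_le_prod TU VU) _.
apply: inj_le_trans U_closed.2; exists (fun p n => if n is 0%N then p.1 else p.2).
move=> [a b] [c d] E; congr (_, _).
  exact: (congr1 (fun u => u 0%N) E).
exact: (congr1 (fun u => u 1%N) E).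
Qed.

Lemma omega_countable (T : countType) : inj_le T U.
Proof.
apply: inj_le_trans U_closed.1; exists choice.pickle.
exact: pcan_inj choice.pickleK.
Qed.

Lemma omega_sum T V : inj_le T U -> inj_le V U -> inj_le (T + V) U.
Proof.
move=> [f fI] [g gI]; apply: inj_le_trans (omega_prod (omega_countable nat) (inj_le_refl U)).
exists (fun s => match s with inl a => (0%N, f a) | inr b => (1%N, g b) end).
by move=> [a|b] [c|d] //= [] => [/fI|/gI] ->.
Qed.

Lemma omega_fun (T : countType) V : inj_le V U -> inj_le (T -> V) U.
Proof.
move=> VU; apply: inj_le_trans (inj_le_fun T VU) _; apply: inj_le_trans U_closed.2.
have [u] := omega_inhabited.
exists (fun h n => if choice.unpickle n is Some t then h t else u) => h h' E.
apply/funext => t; have := congr1 (fun v => v (choice.pickle t)) E.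
by rewrite choice.pickleK.
Qed.

Lemma omega_seq T : inj_le T U -> inj_le (seq T) U.
Proof.
move=> [f fI]; have [u] := omega_inhabited.
apply: inj_le_trans (omega_prod (omega_countable nat) U_closed.2).
exists (fun s => (size s, fun n => nth u (map f s) n)) => s s' [Es En].
apply: (inj_map fI); apply: (@eq_from_nth _ u); first by rewrite !size_map.
by move=> n _; exact: (congr1 (fun v => v n) En).
Qed.

(** Since [(2^U)^aleph_0 = 2^(aleph_0 * U) = 2^U]. *)
Lemma omega_set : omega_closed (set U).
Proof.
have US : inj_le U (set U).
  by exists set1 => x y E; have : [set x] x by []; rewrite E.
split; first exact: inj_le_trans U_closed.1 US.
apply: inj_le_trans (inj_le_uncurry nat U) _; apply: inj_le_set.
exact: omega_prod (omega_countable nat) (inj_le_refl U).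
Qed.

Lemma omega_FA (T : choiceType) : inj_le T U -> inj_le (FA T) U.
Proof.
move=> TU; apply: inj_le_trans (omega_seq (omega_prod TU (omega_countable int))).
have /choice[s sP] (f : FA T) : exists s : seq T, [set t | f t <> 0] = [set` s].
  exact/finite_seqP/FA_fin.
pose enum_supp (f : FA T) := map (fun t => (t, f t)) (s f).
have supp (f : FA T) t : f t <> 0 -> (t, f t) \in enum_supp f.
  move=> ft; apply/mapP; exists t => //.
  by have : [set t | f t <> 0] t by []; rewrite sP.
exists enum_supp => f g E; apply: FAP => t.
have [f0|fn0] := eqVneq (f t) 0.
  have [->|/eqP/supp] := eqVneq (g t) 0; first by [].
  by rewrite -E => /mapP[t' _ [<- ->]].
by move/eqP/supp: fn0; rewrite E => /mapP[t' _ [<- ->]].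
Qed.

End OmegaClosed.

Lemma omega_closed_congr U V : inj_le U V -> inj_le V U -> omega_closed U -> omega_closed V.
Proof.
move=> UV VU [natU UU]; split; first exact: inj_le_trans UV.
exact: inj_le_trans (inj_le_trans (inj_le_fun nat VU) UU) UV.
Qed.

(** For the lower bound, a difference of two [e] generators has no [y] coordinate, so it lies in
    [relK] only if it is 0. *)
Lemma mod_rel_card j (L : choiceType) (x0 : L) m :
  omega_closed L -> [set: mod_rel (k := j.+1) x0 m] #= [set: L].
Proof.
move=> L_closed; have iL := omega_inhabited L_closed.
apply/card_eqPle; split; apply/card_leT_injP => //; last first.
- exists (fun l => \pi_(mod_rel x0 m)%qT (egens (ord0 : 'I_j.+1) 0%N (fun _ _ => l))).
  move=> l l' /eqP; rewrite -Quotient.idealrBE => /asboolP[z zE].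
  have z0 : z = 0.
    apply: FAP => -[eta n]; rewrite FA0; apply: (rels_supp (x0 := x0) (m := m)) => {}n.
    by rewrite zE FAB !diracE.
  move: zE; rewrite z0 raddf0 => /esym/eqP; rewrite subr_eq0 => /eqP.
  move/(congr1 (fun f : FA _ => f (egen ord0 0%N (fun _ _ => l)))).
  rewrite !diracE eqxx; case: eqP => // -[/(congr1 (fun h => h ord0 0%N))] //.
- exact: (inhabits 0).
have LL : inj_le ('I_j.+1 -> nat -> L) L.
  exact/omega_fun/omega_fun/inj_le_refl.
apply: (@inj_le_trans _ (FA (gens j.+1 L))); first by exists repr; exact: can_inj (@reprK _ _).
apply: omega_FA => //; apply: omega_sum => //; apply: omega_prod => //.
  exact: (omega_countable L_closed ('I_j.+1 * nat)%type).
exact: omega_countable.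
Qed.

Lemma inj_has_inv A B (f : A -> B) : inhabited A -> injective f ->
  exists g : B -> A, forall a, g (f a) = a.
Proof.
move=> [a0] fI; have /choice[g gP] b : exists a, (exists a', f a' = b) -> f a = b.
  by have [[a fa]|nb] := pselect (exists a, f a = b); [exists a|exists a0].
by exists g => a; apply/fI/gP; exists a.
Qed.

(** * Coding functions along the sequence of cardinals *)

Section CardinalSequence.
Variables (j : nat) (lam : nat -> Type).
Local Notation k := j.+1.
Hypothesis lam_inf : forall i, (1 <= i <= k)%N -> infinite_set [set: lam i].
Hypothesis lam1 : [set: lam 1%N] #= [set: nat -> lam 1%N].
Hypothesis lamS : forall i, (1 <= i < k)%N -> [set: lam i.+1] #= [set: set (lam i)].

Lemma lam_inhabited i : (1 <= i <= k)%N -> inhabited (lam i).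
Proof. by move=> /lam_inf/infinite_setN0[x _]; exists. Qed.

Lemma lam_set i : (1 <= i < k)%N ->
  inj_le (lam i.+1) (set (lam i)) /\ inj_le (set (lam i)) (lam i.+1).
Proof.
move=> ik; have /card_eqPle[le ge] := lamS ik; split; apply/card_leT_injP => //.
  exact: (inhabits set0).
by apply: lam_inhabited; case/andP: ik.
Qed.

Lemma lam_omega_closed i : (1 <= i <= k)%N -> omega_closed (lam i).
Proof.
case: i => // i; elim: i => [|i IH] ik.
  have inh := lam_inhabited ik; split; apply/card_leT_injP => //.
    exact/infiniteP/lam_inf.
  by case/card_eqPle: lam1.
have [le ge] := lam_set (ik : (1 <= i.+1 < k)%N).
by apply: omega_closed_congr ge le _; apply: omega_set; apply: IH; exact: ltnW.
Qed.

Lemma lam_mono i i' : (1 <= i)%N -> (i <= i')%N -> (i' <= k)%N -> inj_le (lam i) (lam i').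
Proof.
move=> i1; elim: i' => [|i' IH]; first by case: i i1.
rewrite leq_eqVlt => /orP[/eqP-> _|ii' i'k]; first exact: inj_le_refl.
apply: inj_le_trans (IH ii' (ltnW i'k)) _.
have [|_ ge] := @lam_set i'; first by rewrite i'k (leq_trans i1).
apply: inj_le_trans ge; exists set1 => x y E.
by have : [set x] x by []; rewrite E.
Qed.

Local Notation L := {classic lam k}.
Local Notation Lam := ('I_k -> nat -> L).

Variable e : forall i : 'I_k, lam i.+1 -> L.
Arguments e : clear implicits.
Hypothesis e_inj : forall i, injective (e i).
(** Coordinates are numbered from 0 and cardinals from 1, so entries of coordinate [i] range over a
    copy of [lam i.+1]. *)
Let Ls (i : 'I_k) : set L := range (e i).

(** The coordinates before [i] amount to countably many entries from sets no larger than [lam i],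
    and [lam i] equals its countable power. *)
Lemma restriction_code (i : 'I_k) : (0 < i)%N -> exists kappa : Lam -> lam i,
  forall theta theta', below Ls i theta -> below Ls i theta' ->
    kappa theta = kappa theta' -> forall i' : 'I_k, (i' < i)%N -> theta i' = theta' i'.
Proof.
move=> i0; have ik : (1 <= i <= k)%N by rewrite i0 ltnW.
have /choice[u uP] (i' : 'I_k) : exists u : L -> lam i, (i' < i)%N ->
    forall x y, Ls i' x -> Ls i' y -> u x = u y -> x = y.
  have [z] := lam_inhabited ik; have [i'i|_] := ltnP i' i; last by exists (fun=> z).
  have [f fI] := @lam_mono i'.+1 i isT i'i (ltnW (ltn_ord i)).
  have [|g gP] := inj_has_inv _ (e_inj (i := i')); first by apply: lam_inhabited; rewrite ltn_ord.
  by exists (f \o g) => _ _ _ [x _ <-] [y _ <-] /fI; rewrite !gP => ->.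
have [J JI] := omega_fun (lam_omega_closed ik) ('I_k * nat)%type (inj_le_refl (lam i)).
exists (fun theta => J (fun p => u p.1 (theta p.1 p.2))) => th th' Hth Hth' /JI E i' i'i.
apply/funext => t; apply: (uP i' i'i); [exact: Hth|exact: Hth'|].
exact: (congr1 (fun h => h (i', t)) E).
Qed.

(** At coordinate 0 the function is constant and is coded with the natural number in [lam 1]. Later,
    it factors through [lam i] by [restriction_code], and there are at most [2^(lam i)] functions
    from [lam i] to [C]. [decN] precedes [C] because it enters the relations of the group. *)
Lemma codes_exist : exists decN : L -> nat, forall C : zmodType,
  [set: C] #<= [set: lam 1] -> exists guess, forall i, codes (C := C) Ls decN guess i.
Proof.
have k1 : (1 <= 1 <= k)%N by [].
have c1 := lam_omega_closed k1; have [z1] := lam_inhabited k1.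
have [pr prI] := omega_prod c1 (omega_countable c1 nat) (inj_le_refl (lam 1)).
have [||inv0 inv0P] := @inj_has_inv _ _ (e (ord0 : 'I_k) \o pr).
- exact: (inhabits (0%N, z1)).
- exact: inj_comp.
exists (fun l => (inv0 l).1) => C; rewrite card_leT_injP; last exact: (inhabits z1).
move=> C1; suff /choice[guess guessP] i : exists guess : L -> Lam -> C,
    codes Ls (fun l => (inv0 l).1) (fun=> guess) i.
  by exists guess => i a f /(guessP i a f).
have [i0|] := posnP i.
  have {i0} -> : i = ord0 by exact/val_inj.
  have [io ioI] := C1; have [|invC invCP] := inj_has_inv _ ioI; first exact: (inhabits 0).
  exists (fun l _ => invC (inv0 l).2) => a f fE.
  exists ((e ord0 \o pr) (a, io (f (fun _ _ => e ord0 z1)))); split=> [|_|theta _].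
  - by exists (pr (a, io (f (fun _ _ => e ord0 z1)))).
  - by rewrite inv0P.
  - by rewrite inv0P /= invCP; apply: fE.
move=> i0; have ik : (1 <= i <= k)%N by rewrite i0 ltnW.
have Ci : inj_le C (lam i) by apply: inj_le_trans C1 _; apply: lam_mono => //; exact: ltnW.
have [Phi PhiI] : inj_le (lam i -> C) (lam i.+1).
  apply: inj_le_trans (inj_le_graph _ _) _; have [|_ ge] := @lam_set i.
    by rewrite i0 ltn_ord.
  apply: inj_le_trans ge; apply: inj_le_set; apply: omega_prod Ci; last exact: inj_le_refl.
  exact: lam_omega_closed.
have [||inv invP] := @inj_has_inv _ _ (e i \o Phi).
- exact: (inhabits (fun=> 0)).
- by apply: inj_comp PhiI; exact: e_inj.
have [kappa kP] := restriction_code i0.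
exists (fun l theta => inv l (kappa theta)) => a f fE.
(* [h] is [f] read through [kappa], with default 0 at codes that are not attained. *)
have /choice[h hP] z : exists c, forall theta, below Ls i theta -> kappa theta = z -> f theta = c.
  have [[th [Hth <-]]|no] := pselect (exists theta, below Ls i theta /\ kappa theta = z).
    by exists (f th) => th' Hth' E; apply: fE; exact: kP.
  by exists 0 => th Hth E; case: no; exists th.
exists ((e i \o Phi) h); split=> [|iz|theta Hth].
- by exists (Phi h).
- by rewrite iz in i0.
- by rewrite invP; apply/esym/hP.
Qed.

End CardinalSequence.

Theorem lemma19 (k : nat) (lam : nat -> Type) :
  (2 <= k)%N ->
  (forall i : nat, (1 <= i <= k)%N -> infinite_set [set: lam i]) ->
  [set: lam 1%N] #= [set: nat -> lam 1%N] ->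
  (forall i : nat, (1 <= i < k)%N -> [set: lam i.+1] #= [set: set (lam i)]) ->
  exists F : zmodType,
    [/\ aleph_free k F,
        [set: F] #= [set: lam k] &
        forall C : zmodType, [set: C] #<= [set: lam 1%N] ->
          (cotorsion C <-> Ext_eq0 F C)].
Proof.
case: k => // j _ lam_inf lam1 lamS.
have [x0] := lam_inhabited lam_inf (leqnn j.+1 : (1 <= j.+1 <= j.+1)%N).
have emb (i : 'I_j.+1) : {f : lam i.+1 -> {classic lam j.+1} | injective f}.
  by apply: cid; exact: (lam_mono lam_inf lamS (isT : 0 < i.+1)%N (ltn_ord i) (leqnn _)).
pose e i := projT1 (emb i); have e_inj i : injective (e i) := projT2 (emb i).
have [decN all_codes] := codes_exist lam_inf lam1 lamS e_inj.
(* Reading the multipliers off coordinate 0 lets a single group test all sequences of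
   multipliers. *)
exists (mod_rel (x0 : {classic lam j.+1})
  (fun (eta : 'I_j.+1 -> nat -> {classic lam j.+1}) n => decN (eta ord0 n))).
split; first exact: mod_rel_aleph_free.
  by apply: mod_rel_card; apply: (lam_omega_closed lam_inf lam1 lamS); rewrite leqnn.
move=> C C1; split=> [cotC|ext0]; first by apply: cotC; exact: mod_rel_torsion_free.
apply: cotorsion_of_divisor_solvable; have [guess guessP] := all_codes C C1.
exact: Ext_eq0_divisor_solvable guessP ext0.
Qed.
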